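(* Let $J\subseteq\mathbb K[x_1,\dots,x_n]$ be a weighted homogeneous ideal and $C$ a maximal cone in the Gröbner fan of $J$. Let $\mathcal R_C(A)$ be the Rees algebra associated to the PL-quasivaluation on $A=\mathbb K[x_1,\dots,x_n]/J$ defined by $C$, and let $\psi:\operatorname{Spec}(\mathcal R_C(A))\to X_C$ be the corresponding toric family. Then the morphism $\pi:\operatorname{Spec}(\tilde A)\to\mathbb A^m$ fits into a pull-back (Cartesian) diagram $$\begin{array}{ccc}\operatorname{Spec}(\mathcal R_C(A))&\longleftarrow&\operatorname{Spec}(\tilde A)\\ {\scriptstyle\psi}\downarrow&&\downarrow{\scriptstyle\pi}\\ X_C&\xleftarrow{\ p_C\ }&\mathbb A^m\end{array}$$ where $p_C:\mathbb A^m\to X_C$ is the universal torsor (Cox morphism) of $X_C$ and $m$ is the number of rays of $C$. Both flat families, the one defined by $\psi$ and the one defined by $\pi$, are direct sums of line bundles indexed by the standard monomial basis associated to the maximal cone $C$.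
   Context: $\mathbb K$ is an algebraically closed field. Weighted homogeneous: generated by homogeneous elements for a grading $\deg x_i=d_i$ with $\mathbf d\in\mathbb Z_{>0}^n$. For $w\in\mathbb R^n$, $\operatorname{in}_w(f)$ is the sum of the terms $c_\alpha\mathbf x^\alpha$ of $f$ with $w\cdot\alpha$ minimal, and $\operatorname{in}_w(J)=\langle\operatorname{in}_w(f):f\in J\rangle$. The Gröbner fan $\operatorname{GF}(J)$ is the complete fan in $\mathbb R^n$ in which $u,w$ lie in the relative interior of the same cone iff $\operatorname{in}_u(J)=\operatorname{in}_w(J)$; maximal cones have dimension $n$. There is a monomial term order $<$ compatible with $C$, i.e. $\operatorname{in}_<(J)=\operatorname{in}_w(J)$ for $w\in C^\circ$ ($\operatorname{in}_<(f)$ is the $<$-largest term). The standard monomial basis is $\mathbb B_<=\{\bar{\mathbf x}^\alpha:\mathbf x^\alpha\notin\operatorname{in}_<(J)\}$, a vector space basis of $A$. The lineality space is $\mathcal L(J)=\{u:\operatorname{in}_u(J)=J\}$ and $\overline C=C/\mathcal L(J)$ is strongly convex; rays of $C$ means rays of $\overline C$. Lift: let $r_1,\dots,r_m\in C\cap\mathbb Z^n$ be representatives of the primitive ray generators of $\overline C$ and $\mathbf r$ the matrix with rows $r_i$. For $0\ne f=\sum c_\alpha\mathbf x^\alpha\in J$ let $\mu(f)=(\min_{c_\alpha\ne0}r_i\cdot\alpha)_i$, $\tilde f=\sum c_\alpha\mathbf x^\alpha\mathbf t^{\mathbf r\cdot\alpha-\mu(f)}$, $\tilde J=\langle\tilde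 f:f\in J\rangle$, $\tilde A=\mathbb K[t_1,\dots,t_m][x_1,\dots,x_n]/\tilde J$; $\pi$ is induced by $\mathbb K[t_1,\dots,t_m]\to\tilde A$. Rees algebra: let $N=\mathbb Z^n$, $M=N^*$. Let $\mathcal O_C$ be the set of piecewise linear functions on $C\cap N$, ordered pointwise. The PL-quasivaluation $\mathfrak v_C:A\to\mathcal O_C$ is: for $\bar{\mathbf x}^\alpha\in\mathbb B_<$, $\mathfrak v_C(\bar{\mathbf x}^\alpha)$ is the function $w\mapsto w\cdot\alpha$; for $f=\sum_{\bar{\mathbf x}^\alpha\in\mathbb B_<}c_\alpha\bar{\mathbf x}^\alpha$, $\mathfrak v_C(f)=\min_{c_\alpha\ne0}\mathfrak v_C(\bar{\mathbf x}^\alpha)$ (pointwise). For $k\in M$ put $F_k(\mathfrak v_C)=\{f\in A:\mathfrak v_C(f)(w)\ge w\cdot k\ \forall w\in C\cap N\}$, and $\mathcal R_C(A)=\bigoplus_{k\in M}F_k(\mathfrak v_C)t^k$. Let $S_C=-C^\vee\cap M$ with $C^\vee=\{u: w\cdot u\ge0\ \forall w\in C\}$. Then $\mathcal R_C(A)$ is a $\mathbb K[S_C]$-algebra; $X_C=\operatorname{Spec}\mathbb K[S_C]$ is the affine toric variety associated to $C$, and $\psi$ is the structure morphism. The Cox morphism $p_C$ corresponds to $p_C^\#:\mathbb K[S_C]\to\mathbb K[t_1,\dots,t_m]$, $t^{-u}\mapsto\prod_i t_i^{r_i\cdot u}$ for $u\in C^\vee\cap M$. ''Direct sum of line bundles indexed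 by a set'' refers to the quasi-coherent sheaves of algebras $\psi_*\mathcal O$ on $X_C$ and $\pi_*\mathcal O$ on $\mathbb A^m$. *)

(* Defs.v *)
From HB Require Import structures.
From mathcomp Require Import all_boot all_order all_algebra finmap.
From mathcomp Require Import all_classical reals constructive_ereal topology.
From mathcomp Require Import normedtype.
From mathcomp Require mpoly monalg.
(* The notations of multinomials and of mathcomp-analysis cannot be loaded
   together, so the former are left out. *)
Import (canonicals) monalg.
Import -(notations) mpoly.
Set Implicit Arguments.
Unset Strict Implicit.
Unset Printing Implicit Defensive.
Import Order.TTheory GRing.Theory Num.Theory.
Import numFieldNormedType.Exports.
Local Open Scope classical_set_scope.
Local Open Scope ring_scope.
Local Open Scope quotient_scope.

(* [idealr] of the library is restricted to proper ideals; here the unit ideal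
   and the zero quotient ring are allowed. *)

Record ideal (R : comPzRingType) := Ideal {
  ideal_set :> R -> Prop;
  ideal0 : ideal_set 0;
  idealD : forall x y, ideal_set x -> ideal_set y -> ideal_set (x + y);
  idealM : forall a x, ideal_set x -> ideal_set (a * x) }.

Section GeneratedIdeal.
Variables (R : comPzRingType) (S : set R).

Definition gen_set : set R :=
  [set x | exists2 s : seq (R * R), (forall c, c \in s -> S c.2) &
           x = \sum_(c <- s) c.1 * c.2].

Fact gen_set0 : gen_set 0.
Proof. by exists [::] => //; rewrite big_nil. Qed.

Fact gen_setD x y : gen_set x -> gen_set y -> gen_set (x + y).
Proof.
move=> [s sS ->] [t tS ->]; exists (s ++ t); last by rewrite big_cat.
by move=> c; rewrite mem_cat => /orP[/sS|/tS].
Qed.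

Fact gen_setM a x : gen_set x -> gen_set (a * x).
Proof.
move=> [s sS ->]; exists [seq (a * c.1, c.2) | c <- s].
  by move=> _ /mapP[c /sS Sc ->].
by rewrite big_map mulr_sumr; apply: eq_bigr => c _; rewrite mulrA.
Qed.

Definition gen : ideal R := Ideal gen_set0 gen_setD gen_setM.
End GeneratedIdeal.

Section QuotientRing.
Variables (R : comPzRingType) (I : ideal R).

Definition ideal_pred : {pred R} := fun x => `[< I x >].

Fact ideal_predP x : reflect (I x) (x \in ideal_pred).
Proof. exact: asboolP. Qed.

Fact ideal_pred_zmod : zmod_closed ideal_pred.
Proof.
split=> [|x y /ideal_predP Ix /ideal_predP Iy]; apply/ideal_predP.
  exact: ideal0.
by apply: idealD => //; rewrite -mulN1r; apply: idealM.
Qed.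
HB.instance Definition _ := GRing.isZmodClosed.Build R ideal_pred ideal_pred_zmod.

Definition quot_ring : Type := {ideal_quot ideal_pred}.
HB.instance Definition _ := GRing.Zmodule.on quot_ring.

Definition quot_proj (x : R) : quot_ring := \pi_{ideal_quot ideal_pred} x.
Definition quot_repr (a : quot_ring) : R := repr (a : {ideal_quot ideal_pred}).

Lemma quot_reprK : cancel quot_repr quot_proj.
Proof. by move=> a; rewrite /quot_proj /quot_repr reprK. Qed.

Lemma quot_projP x y : (quot_proj x = quot_proj y) <-> I (x - y).
Proof.
rewrite (rwP eqP) /quot_proj -Quotient.idealrBE.
by split=> /ideal_predP.
Qed.

Fact quot_proj_additive : zmod_morphism quot_proj.
Proof. by move=> x y; rewrite /quot_proj !piE. Qed.
HB.instance Definition _ :=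
  GRing.isZmodMorphism.Build R quot_ring quot_proj quot_proj_additive.

Definition quot_one : quot_ring := quot_proj 1.
Definition quot_mul (a b : quot_ring) : quot_ring :=
  quot_proj (quot_repr a * quot_repr b).

Fact quot_projM x y : quot_proj (x * y) = quot_mul (quot_proj x) (quot_proj y).
Proof.
have IB z : I (z - quot_repr (quot_proj z)).
  by apply/quot_projP; rewrite quot_reprK.
apply/quot_projP; set x' := quot_repr _; set y' := quot_repr _.
have -> : x * y - x' * y' = y * (x - x') + x' * (y - y').
  by rewrite !mulrBr addrA [y * x]mulrC [y * x']mulrC subrK.
by apply: idealD; apply: idealM; apply: IB.
Qed.

Fact quot_mulA : associative quot_mul.
Proof.
move=> a b c; rewrite -[a]quot_reprK -[b]quot_reprK -[c]quot_reprK.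
by rewrite -!quot_projM mulrA.
Qed.

Fact quot_mulC : commutative quot_mul.
Proof.
move=> a b; rewrite -[a]quot_reprK -[b]quot_reprK.
by rewrite -!quot_projM mulrC.
Qed.

Fact quot_mul1 : left_id quot_one quot_mul.
Proof. by move=> a; rewrite -[a]quot_reprK -quot_projM mul1r. Qed.

Fact quot_mulDl : left_distributive quot_mul +%R.
Proof.
move=> a b c; rewrite -[a]quot_reprK -[b]quot_reprK -[c]quot_reprK.
by rewrite -raddfD -!quot_projM mulrDl raddfD.
Qed.

HB.instance Definition _ := GRing.Zmodule_isComPzRing.Build quot_ring
  quot_mulA quot_mulC quot_mul1 quot_mulDl.

Fact quot_proj_multiplicative : monoid_morphism quot_proj.
Proof. by split=> // x y; rewrite quot_projM. Qed.
HB.instance Definition _ :=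
  GRing.isMonoidMorphism.Build R quot_ring quot_proj quot_proj_multiplicative.
End QuotientRing.

Section Subring.
Variables (R : comPzRingType) (S : set R).

Definition set_pred : {pred R} := fun x => `[< S x >].

Fact set_predP x : reflect (S x) (x \in set_pred).
Proof. exact: asboolP. Qed.

Definition subring_of (hS : subring_closed set_pred) : Type :=
  {x : R | x \in set_pred}.

Variable hS : subring_closed set_pred.
HB.instance Definition _ := SubChoice.on (subring_of hS).
HB.instance Definition _ :=
  GRing.SubChoice_isSubComPzRing.Build R set_pred (subring_of hS) hS.
End Subring.

(* The group ring A[M] of an additive group M; [gterm a k] below is a t^k.
   The library product on [malg] is restricted to monoids without units and to
   nonzero coefficient rings, whence a product of our own. *)

Definition group_ring (A : comPzRingType) (M : zmodType) : Type := monalg.malg M A.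
HB.instance Definition _ (A : comPzRingType) (M : zmodType) :=
  GRing.Zmodule.copy (group_ring A M) (monalg.malg M A).

Section GroupRing.
Local Open Scope fset_scope.
Local Open Scope ring_scope.
Variables (A : comPzRingType) (M : zmodType).
Local Notation AM := (group_ring A M).
Implicit Types (g : AM) (k : M).

Definition gsupp g : {fset M} := monalg.msupp g.
Definition gcoef k g : A := monalg.mcoeff k g.
Definition gterm (a : A) k : AM := monalg.mkmalgU k a.

Definition gmul g h : AM :=
  \sum_(k <- gsupp g) \sum_(l <- gsupp h) gterm (gcoef k g * gcoef l h) (k + l).

Lemma gcoefP g h : (forall k, gcoef k g = gcoef k h) <-> g = h.
Proof. exact: monalg.malgP. Qed.

Fact gcoef_additive k : zmod_morphism (gcoef k).
Proof. exact: (monalg.mcoeffB (K := M) (G := A)). Qed.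
HB.instance Definition _ k :=
  GRing.isZmodMorphism.Build AM A (gcoef k) (gcoef_additive k).

Lemma gterm0 k : gterm 0 k = 0.
Proof. exact: monalg.monalgU0. Qed.

Lemma gtermD k : {morph gterm^~ k : a b / a + b}.
Proof. exact: (monalg.monalgUD (K := M) (G := A)). Qed.

Lemma gcoef_term a k l : gcoef l (gterm a k) = a *+ (k == l).
Proof. exact: monalg.mcoeffU. Qed.

Lemma gsupp_out g k : k \notin gsupp g -> gcoef k g = 0.
Proof. exact: monalg.mcoeff_outdom. Qed.

Lemma mem_gsupp g k : (k \in gsupp g) = (gcoef k g != 0).
Proof. by rewrite monalg.mcoeff_neq0. Qed.

Lemma gsupp_term a k : gsupp (gterm a k) `<=` [fset k].
Proof. exact: monalg.msuppU_le. Qed.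

Lemma gsuppD g h : gsupp (g + h) `<=` gsupp g `|` gsupp h.
Proof. exact: monalg.msuppD_le. Qed.

Lemma group_ringE g : g = \sum_(k <- gsupp g) gterm (gcoef k g) k.
Proof. exact: monalg.monalgE. Qed.

Lemma gmulEw (d1 d2 : {fset M}) g h : gsupp g `<=` d1 -> gsupp h `<=` d2 ->
  gmul g h = \sum_(k <- d1) \sum_(l <- d2) gterm (gcoef k g * gcoef l h) (k + l).
Proof.
move=> le1 le2; rewrite /gmul (big_fset_incl _ le1) /=.
  apply: eq_bigr => k _; apply: big_fset_incl => // l _ /gsupp_out ->.
  by rewrite mulr0 gterm0.
by move=> k _ /gsupp_out g0; rewrite big1 // => l _; rewrite g0 mul0r gterm0.
Qed.

Fact gmulC : commutative gmul.
Proof.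
move=> g h; rewrite /gmul exchange_big; apply: eq_bigr => l _.
by apply: eq_bigr => k _; rewrite mulrC addrC.
Qed.

Fact gmulDl : left_distributive gmul +%R.
Proof.
move=> g h f; rewrite (gmulEw (gsuppD _ _) (fsubset_refl _)).
rewrite (gmulEw (fsubsetUl (gsupp g) (gsupp h)) (fsubset_refl _)).
rewrite (gmulEw (fsubsetUr (gsupp g) (gsupp h)) (fsubset_refl _)).
rewrite -big_split; apply: eq_bigr => k _ /=.
rewrite -big_split; apply: eq_bigr => l _ /=.
by rewrite raddfD mulrDl gtermD.
Qed.

Lemma gmul_term a b k l : gmul (gterm a k) (gterm b l) = gterm (a * b) (k + l).
Proof.
rewrite (gmulEw (gsupp_term _ _) (gsupp_term _ _)) !big_seq_fset1.
by rewrite !gcoef_term !eqxx.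
Qed.

Fact gmul0 g : gmul 0 g = 0.
Proof. by apply: (addrI (gmul 0 g)); rewrite -gmulDl !addr0. Qed.

Lemma gmul_suml I (s : seq I) (F : I -> AM) h :
  gmul (\sum_(i <- s) F i) h = \sum_(i <- s) gmul (F i) h.
Proof.
exact: (big_morph (gmul^~ h) (fun x y => gmulDl x y h) (gmul0 h)).
Qed.

Lemma gmul_sumr I (s : seq I) (F : I -> AM) h :
  gmul h (\sum_(i <- s) F i) = \sum_(i <- s) gmul h (F i).
Proof. by rewrite gmulC gmul_suml; apply: eq_bigr => i _; rewrite gmulC. Qed.

Fact gmulA : associative gmul.
Proof.
move=> f g h; rewrite [f]group_ringE [g]group_ringE [h]group_ringE.
rewrite !gmul_suml; apply: eq_bigr => i _.
rewrite gmul_sumr [in RHS](gmul_sumr _ _ (gterm _ i)) gmul_suml.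
apply: eq_bigr => j _.
rewrite !gmul_sumr; apply: eq_bigr => k _.
by rewrite !gmul_term mulrA addrA.
Qed.

Definition gone : AM := gterm 1 0.

Fact gmul1 : left_id gone gmul.
Proof.
move=> g; rewrite [in LHS](group_ringE g) gmul_sumr [RHS]group_ringE.
by apply: eq_bigr => k _; rewrite gmul_term mul1r add0r.
Qed.

HB.instance Definition _ :=
  GRing.Zmodule_isComPzRing.Build AM gmulA gmulC gmul1 gmulDl.

Lemma gmulE g h : g * h = gmul g h. Proof. by []. Qed.
End GroupRing.

Section Weights.
Variables (D : realDomainType) (n : nat).

Definition dot (u v : 'rV[D]_n) : D := \sum_i u 0 i * v 0 i.

Definition expv (a : multinom n) : 'rV[D]_n := \row_i (a i)%:R.

(* equal to +oo exactly on the zero polynomial *)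
Definition min_weight (K : nzRingType) (w : 'rV[D]_n) (f : mpoly n K) : \bar D :=
  \big[Order.min/+oo%E]_(a <- msupp f) (dot w (expv a))%:E.

Definition in_w (K : nzRingType) (w : 'rV[D]_n) (f : mpoly n K) : mpoly n K :=
  \sum_(a <- msupp f | (dot w (expv a))%:E == min_weight w f)
     mcoeff a f *: mpolyX K a.

Definition in_w_ideal (K : comNzRingType) (w : 'rV[D]_n) (J : ideal (mpoly n K)) :
  ideal (mpoly n K) := gen [set in_w w f | f in [set f | J f]].
End Weights.

Definition zvec (R : realDomainType) (n : nat) (w : 'rV[int]_n) : 'rV[R]_n :=
  map_mx intr w.

Section GroebnerFan.
Variables (K : closedFieldType) (R : realType) (n : nat).
Local Notation Kx := (mpoly n K).
Implicit Types (J : ideal Kx) (w : 'rV[R]_n) (C : set 'rV[R]_n).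

Definition homogeneous (d : 'I_n -> nat) (f : Kx) : Prop :=
  exists e, forall a, a \in msupp f -> (\sum_i d i * a i)%N = e.

Definition weighted_homogeneous J : Prop :=
  exists2 d : 'I_n -> nat, (forall i, (0 < d i)%N) &
  exists2 S : set Kx, (forall f, S f -> homogeneous d f) &
    ideal_set J = ideal_set (gen S).

(* the relative interior of the cone of the fan that w determines *)
Definition groebner_class J w : set 'rV[R]_n :=
  [set u | ideal_set (in_w_ideal u J) = ideal_set (in_w_ideal w J)].

Definition groebner_fan J : set (set 'rV[R]_n) :=
  [set closure (groebner_class J w) | w in [set: 'rV[R]_n]].

(* [M] exhibits n linearly independent vectors of [C] *)
Definition full_dimensional C : Prop :=
  exists2 M : 'M[R]_n, M \in unitmx & forall i, C (row i M).

(* The fan is complete, so its maximal cones have dimension n. *)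
Definition maximal_cone J C : Prop :=
  [/\ groebner_fan J C,
      forall C', groebner_fan J C' -> C `<=` C' -> C = C' &
      full_dimensional C].

Definition lineality J : set 'rV[R]_n :=
  [set u | ideal_set (in_w_ideal u J) = ideal_set J].

Definition dual_cone C : set 'rV[R]_n :=
  [set u | forall w, C w -> 0 <= dot w u].

(* The image of [v] in C / L spans a ray, i.e. a one-dimensional face cut out
   by some u in the dual cone.  Everything is written upstairs, modulo L. *)
Definition spans_ray C (L : set 'rV[R]_n) (v : 'rV[R]_n) : Prop :=
  [/\ C v, ~ L v &
      exists2 u, dual_cone C u &
        forall w, C w /\ dot w u = 0 <-> exists2 c : R, 0 <= c & L (w - c *: v)].

Record ray_generators J C (m : nat) (r : 'I_m -> 'rV[int]_n) : Prop := {
  ray_in_cone : forall i, C (zvec R (r i));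
  ray_spans : forall i, spans_ray C (lineality J) (zvec R (r i));
  ray_primitive : forall i (s : 'rV[int]_n) (k : nat),
    lineality J (zvec R (r i - s *+ k)) -> k = 1%N;
  ray_unique : forall v, spans_ray C (lineality J) v ->
    exists! i, exists2 c : R, 0 <= c & lineality J (v - c *: zvec R (r i)) }.
End GroebnerFan.

Section TermOrder.
Variables (K : closedFieldType) (n : nat).
Local Notation Kx := (mpoly n K).
Implicit Types (J : ideal Kx) (le : rel (multinom n)).

Definition term_order le : Prop :=
  [/\ total le, antisymmetric le, transitive le,
      forall a b c, le a b -> le (mnm_add a c) (mnm_add b c) &
      forall a, le mnm0 a].

Definition in_le le (f : Kx) : Kx :=
  \sum_(a <- msupp f | all (le^~ a) (msupp f)) mcoeff a f *: mpolyX K a.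

Definition in_le_ideal le J : ideal Kx := gen [set in_le le f | f in [set f | J f]].

Definition compatible (R : realType) J (C : set 'rV[R]_n) le : Prop :=
  forall w, interior C w ->
    ideal_set (in_le_ideal le J) = ideal_set (in_w_ideal w J).

Definition standard J le : set (multinom n) :=
  [set a | ~ in_le_ideal le J (mpolyX K a)].

Definition standard_basis J le : set (quot_ring J) :=
  [set quot_proj J (mpolyX K a) | a in standard J le].

(* the representative of [f] supported on standard monomials *)
Definition std_repr J le (f : quot_ring J) : Kx :=
  xget 0 [set p | (forall a, a \in msupp p -> standard J le a) /\
                  quot_proj J p = f].
End TermOrder.
Arguments standard {K n} J le.
Arguments standard_basis {K n} J le.
Arguments std_repr {K n} J le f.

Section Lift.
Variables (K : closedFieldType) (n m : nat) (r : 'I_m -> 'rV[int]_n).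
Local Notation Kx := (mpoly n K).
Local Notation Kt := (mpoly m K).
Local Notation Ktx := (mpoly n Kt).
Variable J : ideal Kx.

Definition lift_mu (f : Kx) (i : 'I_m) : int := fine (min_weight (r i) f).

(* the entries r_i . a - mu(f)_i are nonnegative for a in the support of f *)
Definition lift_exp (f : Kx) (a : multinom n) : multinom m :=
  Multinom [tuple `|dot (r i) (expv int a) - lift_mu f i|%N | i < m].

Definition lift_poly (f : Kx) : Ktx :=
  \sum_(a <- msupp f)
     (mcoeff a f *: mpolyX K (lift_exp f a)) *: mpolyX Kt a.

Definition lift_ideal : ideal Ktx :=
  gen [set lift_poly f | f in [set f | J f /\ f <> 0]].

Definition lift_algebra : Type := quot_ring lift_ideal.
HB.instance Definition _ := GRing.ComPzRing.on lift_algebra.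

Definition pi_sharp : {rmorphism Kt -> lift_algebra} :=
  quot_proj lift_ideal \o (@mpolyC n Kt).
End Lift.

Section Toric.
Variables (K : closedFieldType) (R : realType) (n : nat) (C : set 'rV[R]_n).
Local Notation KM := (group_ring K 'rV[int]_n).

Definition toric_monoid : set 'rV[int]_n := [set k | dual_cone C (- zvec R k)].

Definition toric_set : set KM :=
  [set g | forall k, gcoef k g != 0 -> toric_monoid k].

Fact zvecD (k l : 'rV[int]_n) : zvec R (k + l) = zvec R k + zvec R l.
Proof. by apply/rowP=> i; rewrite !mxE rmorphD. Qed.

Lemma dotDr (D : realDomainType) (u v w : 'rV[D]_n) :
  dot u (v + w) = dot u v + dot u w.
Proof. by rewrite -big_split; apply: eq_bigr => i _; rewrite !mxE mulrDr. Qed.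

Lemma dotNr (D : realDomainType) (u v : 'rV[D]_n) : dot u (- v) = - dot u v.
Proof. by rewrite -sumrN; apply: eq_bigr => i _; rewrite !mxE mulrN. Qed.

Lemma dot_zvec (u v : 'rV[int]_n) : dot (zvec R u) (zvec R v) = (dot u v)%:~R.
Proof. by rewrite rmorph_sum; apply: eq_bigr => i _; rewrite !mxE -intrM. Qed.

Fact toric_monoid0 : toric_monoid 0.
Proof.
move=> w _; rewrite /dot big1 // => i _.
by rewrite !mxE oppr0 mulr0.
Qed.

Fact toric_monoidD k l :
  toric_monoid k -> toric_monoid l -> toric_monoid (k + l).
Proof.
by move=> Sk Sl w Cw; rewrite zvecD opprD dotDr addr_ge0 // ?Sk ?Sl.
Qed.

Fact toric_set_subring : subring_closed (set_pred toric_set).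
Proof.
split=> [|g h /set_predP Sg /set_predP Sh|g h /set_predP Sg /set_predP Sh].
- apply/set_predP => k; rewrite gcoef_term; have [<- _|_] := eqVneq 0 k.
    exact: toric_monoid0.
  by rewrite mulr0n eqxx.
- apply/set_predP => k; rewrite raddfB /=.
  have [g0|/Sg//] := eqVneq (gcoef k g) 0.
  by rewrite g0 sub0r oppr_eq0; apply: Sh.
- apply/set_predP => k; rewrite gmulE /gmul.
  move=> nz; apply: contrapT => Sk; move/eqP: nz; apply; rewrite raddf_sum big_seq big1 // => i gi /=.
  rewrite raddf_sum big_seq big1 // => j hj /=.
  rewrite gcoef_term; case: eqP => // ij; case: Sk; rewrite -ij.
  by apply: toric_monoidD; [apply: Sg|apply: Sh]; rewrite -mem_gsupp.
Qed.

Definition toric_algebra : Type := subring_of toric_set_subring.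
HB.instance Definition _ := GRing.ComPzRing.on toric_algebra.
Definition toric_val (g : toric_algebra) : KM := val g.
HB.instance Definition _ := GRing.RMorphism.copy toric_val
  (val : subring_of toric_set_subring -> KM).

Section Cox.
Variables (m : nat) (r : 'I_m -> 'rV[int]_n).
Hypothesis rC : forall i, C (zvec R (r i)).

(* for k = -u in S_C the exponent r_i . u = - r_i . k is nonnegative *)
Definition cox_exp (k : 'rV[int]_n) : multinom m :=
  Multinom [tuple `|dot (r i) k|%N | i < m].

Definition cox_ext (g : KM) : mpoly m K :=
  \sum_(k <- gsupp g) gcoef k g *: mpolyX K (cox_exp k).

Definition cox_fun (g : toric_algebra) : mpoly m K := cox_ext (toric_val g).

Lemma cox_extEw (d : {fset 'rV[int]_n}) (g : KM) : (gsupp g `<=` d)%fset ->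
  cox_ext g = \sum_(k <- d) gcoef k g *: mpolyX K (cox_exp k).
Proof.
move=> gd; rewrite /cox_ext (big_fset_incl _ gd) // => k _ /gsupp_out ->.
by rewrite scale0r.
Qed.

Fact cox_extD g h : cox_ext (g + h) = cox_ext g + cox_ext h.
Proof.
rewrite (cox_extEw (gsuppD g h)) (cox_extEw (fsubsetUl (gsupp g) (gsupp h))).
rewrite (cox_extEw (fsubsetUr (gsupp g) (gsupp h))) -big_split.
by apply: eq_bigr => k _; rewrite raddfD scalerDl.
Qed.

Fact cox_ext0 : cox_ext 0 = 0.
Proof. by apply: (addrI (cox_ext 0)); rewrite -cox_extD !addr0. Qed.

Lemma cox_ext_sum I (s : seq I) (P : pred I) (F : I -> KM) :
  cox_ext (\sum_(i <- s | P i) F i) = \sum_(i <- s | P i) cox_ext (F i).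
Proof. exact: (big_morph _ cox_extD cox_ext0). Qed.

Fact cox_ext_term a k : cox_ext (gterm a k) = a *: mpolyX K (cox_exp k).
Proof.
by rewrite (cox_extEw (gsupp_term _ _)) big_seq_fset1 gcoef_term eqxx.
Qed.

Fact cox_le0 i k : toric_monoid k -> dot (r i) k <= 0.
Proof.
move=> /(_ _ (rC i)); rewrite dotNr dot_zvec oppr_ge0.
by rewrite -(ler_int R).
Qed.

Fact cox_expD k l : toric_monoid k -> toric_monoid l ->
  cox_exp (k + l) = mnm_add (cox_exp k) (cox_exp l).
Proof.
move=> Sk Sl; apply/mnmP=> i; rewrite mnmDE !mnm_tnth !tnth_mktuple dotDr.
apply/eqP; rewrite -eqz_nat PoszD.
by rewrite !abszE !ler0_norm ?cox_le0 ?opprD // -dotDr cox_le0 //;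
   apply: toric_monoidD.
Qed.

Fact cox_zmod_morphism : zmod_morphism cox_fun.
Proof.
move=> g h; rewrite /cox_fun raddfB; apply: (addIr (cox_ext (toric_val h))).
by rewrite -cox_extD !subrK.
Qed.

Fact cox_monoid_morphism : monoid_morphism cox_fun.
Proof.
split.
  rewrite /cox_fun rmorph1 cox_ext_term scale1r.
  have -> : cox_exp 0 = mnm0.
    apply/mnmP=> i; rewrite mnm0E mnm_tnth tnth_mktuple.
    by rewrite /dot big1 // => j _; rewrite mxE mulr0.
  exact: mpolyX0.
move=> g h; rewrite /cox_fun rmorphM gmulE /gmul cox_ext_sum.
have S (f : toric_algebra) k : k \in gsupp (toric_val f) -> toric_monoid k.
  by rewrite mem_gsupp; have /set_predP Sf := valP f; apply: Sf.
rewrite [X in _ = X * _]/cox_ext mulr_suml big_seq [RHS]big_seq.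
apply: eq_bigr => k /S Sk; rewrite cox_ext_sum mulr_sumr.
rewrite big_seq [RHS]big_seq; apply: eq_bigr => l /S Sl.
rewrite cox_ext_term cox_expD // mpolyXD.
by rewrite -scalerAl -scalerAr scalerA.
Qed.

HB.instance Definition _ := GRing.isZmodMorphism.Build
  toric_algebra (mpoly m K) cox_fun cox_zmod_morphism.
HB.instance Definition _ := GRing.isMonoidMorphism.Build
  toric_algebra (mpoly m K) cox_fun cox_monoid_morphism.

Definition cox_sharp : {rmorphism toric_algebra -> mpoly m K} := cox_fun.
End Cox.
End Toric.

Section Rees.
Variables (K : closedFieldType) (R : realType) (n : nat).
Variables (J : ideal (mpoly n K)) (le : rel (multinom n)) (C : set 'rV[R]_n).

Definition lattice_point : Type := {w : 'rV[int]_n | C (zvec R w)}.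

(* the value at f = 0 is the constant +oo *)
Definition quasival (f : quot_ring J) (w : lattice_point) : \bar int :=
  min_weight (sval w) (std_repr J le f).

Definition filt (k : 'rV[int]_n) : set (quot_ring J) :=
  [set f | forall w : lattice_point, ((dot (sval w) k)%:E <= quasival f w)%E].

Definition rees_set : set (group_ring (quot_ring J) 'rV[int]_n) :=
  [set g | forall k, filt k (gcoef k g)].
End Rees.
Arguments quasival {K R n} J le C.
Arguments filt {K R n} J le C.
Arguments rees_set {K R n} J le C.

(* The square of affine schemes dual to
       B --h--> P
       ^        ^
       f        k
       |        |
       R --g--> T
   is Cartesian: it commutes and, for every commutative ring Q, the Q-points of
   Spec P are the pairs of Q-points of Spec B and Spec T over Spec R. *)
Definition cartesian_square (R B T P : comPzRingType)
    (f : {rmorphism R -> B}) (g : {rmorphism R -> T})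
    (h : {rmorphism B -> P}) (k : {rmorphism T -> P}) : Prop :=
  (forall x, h (f x) = k (g x)) /\
  forall (Q : comPzRingType) (b : {rmorphism B -> Q}) (t : {rmorphism T -> Q}),
    (forall x, b (f x) = t (g x)) ->
    exists p : {rmorphism P -> Q},
      [/\ forall x, p (h x) = b x, forall x, p (k x) = t x &
          forall p' : {rmorphism P -> Q}, (forall x, p' (h x) = b x) ->
            (forall x, p' (k x) = t x) -> forall y, p' y = p y].

(* the target of a ring morphism as a module over its source; for Spec B over
   Spec R it is the module of global sections of the direct image of O *)
Definition push_module (R B : comPzRingType) (f : {rmorphism R -> B}) : Type := B.

Section PushModule.
Variables (R B : comPzRingType) (f : {rmorphism R -> B}).
HB.instance Definition _ := GRing.Zmodule.on (push_module f).

Definition push_scale (a : R) (x : push_module f) : push_module f := f a * (x : B).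

Fact push_scaleA a b v : push_scale a (push_scale b v) = push_scale (a * b) v.
Proof. by rewrite /push_scale rmorphM mulrA. Qed.
Fact push_scale1 : left_id 1 push_scale.
Proof. by move=> v; rewrite /push_scale rmorph1 mul1r. Qed.
Fact push_scaleDr : right_distributive push_scale +%R.
Proof. by move=> a u v; rewrite /push_scale mulrDr. Qed.
Fact push_scaleDl v : {morph push_scale^~ v : a b / a + b}.
Proof. by move=> a b; rewrite /push_scale rmorphD mulrDl. Qed.

HB.instance Definition _ := GRing.Zmodule_isLmodule.Build R (push_module f)
  push_scaleA push_scale1 push_scaleDr push_scaleDl.
End PushModule.

Section Modules.
Variable R : comPzRingType.

Definition bilinear_map (U V W : lmodType R) (b : U -> V -> W) : Prop :=
  (forall u, linear (b u)) /\ (forall v, linear (b^~ v)).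

(* sum_i u_i (x) v_i = 0 in the tensor product of U and V *)
Definition tensor_zero (U V : lmodType R) (p : nat) (u : 'I_p -> U) (v : 'I_p -> V) :
  Prop := forall (W : lmodType R) (b : U -> V -> W), bilinear_map b ->
    \sum_i b (u i) (v i) = 0.

(* tensoring with M preserves injectivity *)
Definition flat (M : lmodType R) : Prop :=
  forall (U V : lmodType R) (j : {linear U -> V}), injective j ->
  forall (p : nat) (u : 'I_p -> U) (x : 'I_p -> M),
    tensor_zero (fun i => j (u i)) x -> tensor_zero u x.

Definition submodule (M : lmodType R) (L : set M) : Prop :=
  L 0 /\ forall a x y, L x -> L y -> L (a *: x + y).

(* After inverting s, the module L becomes free with basis e: the second clause
   is generation and the third one freeness, with denominators cleared. *)
Definition free_of_rank1_away (M : lmodType R) (L : set M) (s : R) : Prop :=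
  exists e, [/\ L e,
    forall x, L x -> exists N a, s ^+ N *: x = a *: e &
    forall a, a *: e = 0 -> exists N, s ^+ N * a = 0].

(* L is locally free of rank 1 on a cover of Spec R by basic open sets *)
Definition line_bundle (M : lmodType R) (L : set M) : Prop :=
  submodule L /\
  exists (p : nat) (s c : 'I_p -> R), \sum_i c i * s i = 1 /\
    forall i, free_of_rank1_away L (s i).

Definition direct_sum_of_line_bundles (M : lmodType R) (I : choiceType) (B : set I) :
  Prop :=
  exists L : I -> set M,
    [/\ forall i, B i -> line_bundle (L i),
        forall x, exists (s : seq I) (y : I -> M),
          [/\ uniq s, forall i, i \in s -> B i /\ L i (y i) &
              x = \sum_(i <- s) y i] &
        forall (s : seq I) (y : I -> M), uniq s ->
          (forall i, i \in s -> B i /\ L i (y i)) ->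
          \sum_(i <- s) y i = 0 -> forall i, i \in s -> y i = 0].
End Modules.

(* Main.v *)
Require Import Defs.
From HB Require Import structures.
From mathcomp Require Import all_boot all_order all_algebra finmap.
From mathcomp Require Import all_classical reals constructive_ereal topology.
From mathcomp Require Import normedtype.
From mathcomp Require Import ring lra.
From mathcomp Require mpoly monalg.
Import (canonicals) monalg.
Import -(notations) mpoly.
Set Implicit Arguments.
Unset Strict Implicit.
Unset Printing Implicit Defensive.
Import Order.TTheory GRing.Theory Num.Theory.
Import numFieldNormedType.Exports.
Local Open Scope classical_set_scope.
Local Open Scope ring_scope.

(** Both families are free modules on the standard monomials, and the square
    matches the two bases; everything else is formal.

    _The initial ideal._  Write C as the closure of a class G of weights sharing
    one initial ideal I.  As C spans R^n, so does G, hence the ideal I, which is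
    homogeneous for every weight of G, is a monomial ideal
    ([in_ideal_monomial]).  Because J is homogeneous for a positive grading,
    reduction modulo J stays among finitely many monomials and terminates, so
    that the monomials outside I form a basis of A ([std_indep], [std_nf]).  If
    x^a lies in I and q is its normal form, then u.a < u.b for all u in G and all
    monomials x^b of q, as in_u(x^a - q) can only involve x^a; conversely these
    inequalities characterize G ([class_raises_weight],
    [raises_weight_class]).  So G is a convex cone.  It follows that the interior
    of C is nonempty and meets G, which identifies I with the initial ideal of
    the term order, and that the lattice points of C detect its dual cone
    ([standard_monomials]).

    _The Rees algebra._  Since normal forms do not lower weights on C, the
    filtration step F_k is spanned by the standard x^a with a - k in the dual
    cone of C.  Hence the Rees algebra, inside the group ring A[Z^n], is free over
    K[S_C] on the elements x^a t^a, for x^a standard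
    ([rees_generating], [rees_independent]).

    _The lift._  The map x^a -> x^a t^(- r.a) sends the lift of f to
    t^(- mu(f)) f, and so defines a K[t]-linear ring morphism from the lifted
    algebra to A[Z^m] ([lift_embedding]).  Lifting the relations x^a - q shows
    that the standard monomials generate the lifted algebra over K[t]
    ([lift_generating]), and their images in A[Z^m] are independent: they are
    a basis, and the morphism is an embedding ([embedding_inj]).

    _The square._  The morphism A[Z^n] -> A[Z^m] given by t^k -> t^(- r.k) extends
    the Cox morphism and carries x^a t^a to the image of x^a.  It therefore maps
    the Rees algebra into the lifted algebra ([rees_to_lift_ex]).  For the
    universal property, compatible morphisms b and t to a ring Q force
    x^a -> b(x^a t^a); this respects the lifts because every relation
    x^a = q of A already holds, homogenized, in the Rees algebra
    ([rees_relation], [square_cartesian]). *)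

(** * Construction of ring morphisms *)
Section MakeMorphism.
Variables (A B : pzRingType) (f : A -> B).
Hypotheses (fB : zmod_morphism f) (fM : monoid_morphism f).

Lemma rmorphism_of_fun : exists F : {rmorphism A -> B}, F =1 f.
Proof.
pose F : {rmorphism A -> B} := HB.pack f
  (GRing.isZmodMorphism.Build A B f fB) (GRing.isMonoidMorphism.Build A B f fM).
by exists F.
Qed.
End MakeMorphism.

Lemma quot_factor (R Q : comPzRingType) (S : set R) (q : {rmorphism R -> Q}) :
    (forall x, S x -> q x = 0) ->
  exists p : {rmorphism quot_ring (gen S) -> Q},
    forall x, p (quot_proj (gen S) x) = q x.
Proof.
move=> qS; have q0 x : gen S x -> q x = 0.
  case=> s sS ->; rewrite rmorph_sum big_seq big1 // => c /sS/qS qc.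
  by rewrite rmorphM qc mulr0.
pose f (y : quot_ring (gen S)) := q (quot_repr y).
have fE x : f (quot_proj (gen S) x) = q x.
  apply/eqP; rewrite -subr_eq0 -rmorphB; apply/eqP/q0.
  by apply/quot_projP; rewrite quot_reprK.
have [||F FE] := @rmorphism_of_fun _ _ f; last by exists F => x; rewrite FE fE.
  move=> x y; rewrite -[x]quot_reprK -[y]quot_reprK -rmorphB !fE.
  exact: rmorphB.
split=> [|x y]; last first.
  rewrite -[x]quot_reprK -[y]quot_reprK -rmorphM !fE; exact: rmorphM.
by rewrite -(rmorph1 (quot_proj (gen S))) fE rmorph1.
Qed.

(** How the morphisms into a subring and into the lifted algebra are obtained:
    it is enough to describe their values in an ambient ring, where the
    multiplicativity is plain. *)
Lemma lift_injective (B P Q : pzRingType) (E : {rmorphism P -> Q})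
    (F : {rmorphism B -> Q}) : injective E ->
    (forall b, exists p, E p = F b) ->
  exists G : {rmorphism B -> P}, forall b, E (G b) = F b.
Proof.
move=> Einj /boolp.choice[g gE].
have [||G GE] := @rmorphism_of_fun _ _ g; last by exists G => b; rewrite GE.
  by move=> x y; apply: Einj; rewrite rmorphB !gE rmorphB.
by split=> [|x y]; apply: Einj; rewrite ?rmorph1 ?rmorphM !gE ?rmorph1 ?rmorphM.
Qed.

Section PolyExtension.
Variables (n : nat) (R : comNzRingType) (Q : comPzRingType).
Variables (t : {rmorphism R -> Q}) (e : multinom n -> Q).
Hypotheses (e0 : e (mnm0 (n := n)) = 1).
Hypothesis (eD : forall a b, e (mnm_add a b) = e a * e b).

(** The target [Q] may be the zero ring, because the universal property of a
    fibre product quantifies over all commutative rings.  The family [e] is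
    arbitrary at first: the homogenization of polynomials for a fixed weight
    bound is additive but not multiplicative. *)
Definition mext (p : mpoly n R) : Q := \sum_(a <- msupp p) t (mcoeff a p) * e a.

Lemma mextEw (d : seq (multinom n)) p : uniq d -> {subset msupp p <= d} ->
  mext p = \sum_(a <- d) t (mcoeff a p) * e a.
Proof.
move=> ud sd; rewrite (bigID [in msupp p]) /= [X in _ + X]big1 ?addr0.
  rewrite -big_filter; apply: perm_big; apply: uniq_perm.
  - exact: msupp_uniq.
  - exact: filter_uniq.
  - by move=> a; rewrite mem_filter andb_idr // => /sd.
by move=> a /memN_msupp_eq0 ->; rewrite rmorph0 mul0r.
Qed.

Lemma mextB : zmod_morphism mext.
Proof.
move=> p q; pose d := undup (msupp p ++ msupp q ++ msupp (p - q)).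
have ud : uniq d by apply: undup_uniq.
have sd x : x \in [:: p; q; p - q] -> {subset msupp x <= d}.
  move=> xin a ax; rewrite mem_undup !mem_cat.
  by move: xin; rewrite !inE => /or3P[] /eqP <-; rewrite ax ?orbT.
rewrite !(mextEw ud (sd _ _)) ?inE ?eqxx ?orbT //.
by rewrite -sumrB; apply: eq_bigr => a _; rewrite mcoeffB rmorphB mulrBl.
Qed.

HB.instance Definition _ := GRing.isZmodMorphism.Build _ _ mext mextB.

Lemma mextX c a : mext (c *: mpolyX R a) = t c * e a.
Proof.
rewrite (@mextEw [:: a]) // => [|b /msuppZ_le]; last by rewrite msuppX.
by rewrite big_seq1 mcoeffZ mcoeffX eqxx mulr1.
Qed.

Lemma mextM : monoid_morphism mext.
Proof.
split=> [|p q].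
  by rewrite -mpolyX0 -[mpolyX R _]scale1r mextX rmorph1 mul1r.
rewrite [in LHS](mpolyE p) [in LHS](mpolyE q) mulr_suml raddf_sum /=.
rewrite /(mext p) mulr_suml; apply: eq_bigr => a _.
rewrite mulr_sumr raddf_sum /(mext q) mulr_sumr; apply: eq_bigr => b _ /=.
rewrite -scalerAl -scalerAr scalerA -mpolyXD mextX rmorphM eD.
by rewrite mulrACA.
Qed.

Lemma poly_extension : exists E : {rmorphism mpoly n R -> Q},
  forall c a, E (c *: mpolyX R a) = t c * e a.
Proof.
by have [E EE] := rmorphism_of_fun mextB mextM; exists E => c a; rewrite EE mextX.
Qed.
End PolyExtension.

Section GroupRingMaps.
Variables (A B : comPzRingType) (M N : zmodType).
Variables (h : {rmorphism A -> B}) (f : M -> N).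
Hypothesis (fD : forall k l, f (k + l) = f k + f l).
Local Open Scope fset_scope.
Local Open Scope ring_scope.

Definition gmap (g : group_ring A M) : group_ring B N :=
  \sum_(k <- gsupp g) gterm (h (gcoef k g)) (f k).

Lemma gmapEw (d : {fset M}) g : gsupp g `<=` d ->
  gmap g = \sum_(k <- d) gterm (h (gcoef k g)) (f k).
Proof.
move=> gd; rewrite /gmap (big_fset_incl _ gd) // => k _ /gsupp_out ->.
by rewrite rmorph0 gterm0.
Qed.

Lemma gmapD g g' : gmap (g + g') = gmap g + gmap g'.
Proof.
rewrite (gmapEw (gsuppD g g')) (gmapEw (fsubsetUl (gsupp g) (gsupp g'))).
rewrite (gmapEw (fsubsetUr (gsupp g) (gsupp g'))) -big_split.
by apply: eq_bigr => k _; rewrite !raddfD gtermD.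
Qed.

Lemma gmapB : zmod_morphism gmap.
Proof.
by move=> g g'; apply: (addIr (gmap g')); rewrite -gmapD !subrK.
Qed.
HB.instance Definition _ := GRing.isZmodMorphism.Build _ _ gmap gmapB.

Lemma gmap_term a k : gmap (gterm a k) = gterm (h a) (f k).
Proof. by rewrite (gmapEw (gsupp_term _ _)) big_seq_fset1 gcoef_term eqxx. Qed.

Lemma gmapM : monoid_morphism gmap.
Proof.
have f0 : f 0 = 0 by apply: (addrI (f 0)); rewrite -fD !addr0.
split=> [|g g']; first by rewrite gmap_term rmorph1 f0.
rewrite [g in LHS]group_ringE [g' in LHS]group_ringE mulr_suml !raddf_sum /=.
rewrite /(gmap g) mulr_suml; apply: eq_bigr => a _.
rewrite mulr_sumr raddf_sum /(gmap g') mulr_sumr; apply: eq_bigr => b _ /=.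
by rewrite !gmulE !gmul_term gmap_term fD rmorphM.
Qed.

Lemma group_ring_map : exists G : {rmorphism group_ring A M -> group_ring B N},
  forall a k, G (gterm a k) = gterm (h a) (f k).
Proof.
by have [G GE] := rmorphism_of_fun gmapB gmapM; exists G => a k; rewrite GE gmap_term.
Qed.
End GroupRingMaps.

(** * Free modules *)
Section FreeModule.
Local Open Scope fset_scope.
Local Open Scope ring_scope.
Variables (R : comPzRingType) (M : lmodType R) (I : choiceType).
Variables (B : set I) (e : I -> M).

Definition generating : Prop := forall x, exists2 s : seq (R * I),
  forall c, c \in s -> B c.2 & x = \sum_(c <- s) c.1 *: e c.2.

Definition independent : Prop := forall (s : {fset I}) (a : I -> R),
  (forall i, i \in s -> B i) -> \sum_(i <- s) a i *: e i = 0 ->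
  forall i, i \in s -> a i = 0.

Hypotheses (gen_e : generating) (ind_e : independent).

Definition expands (x : M) (s : {fset I}) (a : I -> R) : Prop :=
  [/\ forall i, i \in s -> B i, forall i, i \notin s -> a i = 0 &
      x = \sum_(i <- s) a i *: e i].

Lemma expands_ex x : exists sa : {fset I} * (I -> R), expands x sa.1 sa.2.
Proof.
have [s sB ->] := gen_e x.
exists ([fset c.2 | c in s], fun i => \sum_(c <- s | c.2 == i) c.1).
split=> /= [i /imfsetP[c /= /sB Bc ->] //|i si|].
  rewrite big_seq_cond big1 // => c /andP[cs /eqP ci]; case/negP: si.
  by apply/imfsetP; exists c.
under [RHS]eq_bigr => i _ do rewrite scaler_suml.
rewrite (exchange_big_dep predT) //= big_seq [RHS]big_seq.
apply: eq_bigr => c cs; rewrite -big_filter.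
have -> : [seq i <- [fset c.2 | c in s] | c.2 == i] = [:: c.2].
  apply: perm_small_eq => //; apply: uniq_perm => // [|i].
    exact: filter_uniq.
  rewrite mem_filter inE eq_sym andb_idr // => /eqP ->.
  by apply/imfsetP; exists c.
by rewrite big_seq1.
Qed.

Lemma expandsEw x s a d : expands x s a -> s `<=` d ->
  x = \sum_(i <- d) a i *: e i.
Proof.
case=> _ a0 -> sd; apply: big_fset_incl => // i _ /a0 ->.
exact: scale0r.
Qed.

(** Comparison of two expansions on the union of their supports. *)
Lemma expands_uniq x s a s' a' : expands x s a -> expands x s' a' -> a =1 a'.
Proof.
move=> xa xa' i.
have [si|si] := boolP (i \in s `|` s'); last first.
  case: xa xa' => _ a0 _ [_ a0' _]; move: si; rewrite in_fsetU negb_or.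
  by case/andP=> /a0 -> /a0' ->.
apply/eqP; rewrite -subr_eq0; apply/eqP.
apply: (ind_e (s := s `|` s') (a := fun i => a i - a' i)) => //.
  by move=> k; rewrite in_fsetU; case: xa xa' => + _ _ [+ _ _] => + + /orP[]; auto.
under eq_bigr => k _ do rewrite scalerBl.
rewrite sumrB -(expandsEw xa (fsubsetUl _ _)) -(expandsEw xa' (fsubsetUr _ _)).
exact: subrr.
Qed.

Lemma free_coordinates : exists c : I -> M -> R,
  (forall i a x y, c i (a *: x + y) = a * c i x + c i y) /\
  (forall x, exists s, expands x s (c^~ x)).
Proof.
have [f fE] := boolp.choice expands_ex.
exists (fun i x => (f x).2 i); split=> [i a x y|x]; last by exists (f x).1.
pose s := (f x).1 `|` (f y).1.
apply: (expands_uniq (fE _)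
  (s' := s) (a' := fun i => a * (f x).2 i + (f y).2 i)).
have [[Bx x0 _] [By y0 _]] := (fE x, fE y).
split=> [k|k|].
- by rewrite in_fsetU => /orP[/Bx|/By].
- rewrite in_fsetU negb_or => /andP[/x0 -> /y0 ->].
  by rewrite mulr0 addr0.
have xE := expandsEw (fE x) (fsubsetUl _ (f y).1).
have yE := expandsEw (fE y) (fsubsetUr (f x).1 _).
transitivity (a *: (\sum_(k <- s) (f x).2 k *: e k) +
  \sum_(k <- s) (f y).2 k *: e k); first by rewrite -xE -yE.
rewrite scaler_sumr -big_split /=; apply: eq_bigr => k _.
by rewrite scalerA scalerDl.
Qed.

(** The coordinate [c k] gives, for each k, a bilinear map to V that sends
    u (x) y to [c k y *: u]; so a vanishing tensor in V has vanishing
    coordinates, these come from U by the injection j, and the tensor over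
    U is recovered from its coordinates. *)
Lemma free_flat : flat M.
Proof.
have [c [cL cE]] := free_coordinates.
move=> U V j jinj p u x tz.
have [s sE] := boolp.choice (fun i => cE (x i)).
have u0 k : \sum_i c k (x i) *: u i = 0.
  apply: jinj; rewrite raddf0 raddf_sum -[RHS](tz V (fun v y => c k y *: v)).
    apply: eq_bigr => i _; exact: linearZ_LR.
  split=> [v a y z|y a v w]; first by rewrite cL scalerDl scalerA.
  by rewrite scalerDr !scalerA mulrC.
move=> W b [bl br].
have b0 v : b v 0 = 0.
  by have := bl v (-1) 0 0; rewrite scaler0 add0r scaleN1r addNr.
have b0l y : b 0 y = 0.
  by have := br y (-1) 0 0; rewrite scaler0 add0r scaleN1r addNr.
have bsum v (d : seq I) (a : I -> R) :
    b v (\sum_(k <- d) a k *: e k) = \sum_(k <- d) a k *: b v (e k).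
  elim: d => [|k d IH]; first by rewrite !big_nil.
  by rewrite !big_cons bl IH.
have bsuml y (q : seq 'I_p) (a : 'I_p -> R) (v : 'I_p -> U) :
    b (\sum_(i <- q) a i *: v i) y = \sum_(i <- q) a i *: b (v i) y.
  elim: q => [|k q IH]; first by rewrite !big_nil.
  by rewrite !big_cons br IH.
pose d := \bigcup_(i <- index_enum 'I_p) s i.
have -> : \sum_i b (u i) (x i) = \sum_i \sum_(k <- d) c k (x i) *: b (u i) (e k).
  apply: eq_bigr => i _; rewrite -bsum -(expandsEw (sE i)) //.
  by apply: bigfcup_sup; rewrite ?mem_index_enum.
rewrite exchange_big big1 // => k _.
by rewrite -bsuml u0 b0l.
Qed.

(** Each basis vector spans a free module of rank 1, so the trivial cover
    by the unit suffices; [g] renames the index set. *)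
Lemma free_direct_sum (I' : choiceType) (g : I -> I') :
    (forall i k, B i -> B k -> g i = g k -> i = k) ->
  direct_sum_of_line_bundles M [set g i | i in B].
Proof.
move=> ginj.
have ind1 i a : B i -> a *: e i = 0 -> a = 0.
  move=> Bi ae; apply: (ind_e (s := [fset i]) (a := fun=> a) _ _ (fset11 i)).
    by move=> k /fset1P ->.
  by rewrite big_seq_fset1.
exists (fun i' => [set x | exists i, [/\ B i, g i = i' & exists a, x = a *: e i]]).
split.
- move=> _ [i Bi <-]; split.
    split; first by exists i; split=> //; exists 0; rewrite scale0r.
    move=> a _ _ [k [Bk gk [b ->]]] [l [Bl gl [c ->]]].
    have -> : l = k by apply: ginj => //; rewrite gl gk.
    by exists k; split=> //; exists (a * b + c); rewrite scalerDl scalerA.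
  exists 1%N, (fun=> 1), (fun=> 1); split; first by rewrite big_ord1 mulr1.
  move=> _; exists (e i); split.
  + by exists i; split=> //; exists 1; rewrite scale1r.
  + move=> _ [k [Bk /ginj -> // [a ->]]].
    by exists 0%N, a; rewrite expr0 scale1r.
  + by move=> a /(ind1 _ _ Bi) ->; exists 0%N; rewrite mulr0.
- move=> x; have [[s a] /= [sB _ ->]] := expands_ex x.
  pose y i' := \sum_(i <- s | g i == i') a i *: e i.
  have yE i : i \in s -> y (g i) = a i *: e i.
    move=> si; rewrite /y -big_filter.
    have -> : [seq k <- s | g k == g i] = [:: i]; last by rewrite big_seq1.
    apply: perm_small_eq => //; apply: uniq_perm => // [|k].
      exact: filter_uniq.
    rewrite mem_filter inE; apply/andP/eqP => [[/eqP gk sk]|->//].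
    by apply: ginj; rewrite ?gk //; apply: sB.
  exists (map g s), y; split.
  + by rewrite map_inj_in_uniq // => i k si sk; apply: ginj; apply: sB.
  + move=> _ /mapP[i si ->]; split; first by exists i => //; apply: sB.
    by exists i; split=> //; [exact: sB|exists (a i); exact: yE].
  + by rewrite big_map big_seq [RHS]big_seq; apply: eq_bigr => i /yE.
- move=> s y us sy y0 i0 si0.
  have [_ [k0 [Bk0 _ _]]] := sy _ si0.
  have /boolp.choice[h hE] (i : I') : exists ka : I * R,
      i \in s -> [/\ B ka.1, g ka.1 = i & y i = ka.2 *: e ka.1].
    have [si|_] := boolP (i \in s); last by exists (k0, 0).
    by have [_ [k [Bk gk [a yi]]]] := sy _ si; exists (k, a).
  have hK : {in s, cancel (fun i => (h i).1) g} by move=> i /hE[].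
  pose t := [seq (h i).1 | i <- s].
  have ut : uniq t by rewrite map_inj_in_uniq //; apply: (can_in_inj hK).
  have tE k : (k \in [fset k in t]) = (k \in t) by rewrite in_fset_.
  have := ind_e (s := [fset k in t]) (a := fun k => (h (g k)).2).
  move=> /(_ _ _ (h i0).1) h0.
  have [_ _ ->] := hE _ si0; rewrite -[in (h i0).2](hK _ si0) h0 ?scale0r //.
  + by move=> k; rewrite tE => /mapP[i /hE[Bi _ _] ->].
  + rewrite -[RHS]y0 (perm_big t) /=; last by apply: uniq_perm.
    rewrite big_map big_seq [RHS]big_seq; apply: eq_bigr => i si.
    by rewrite hK //; have [_ _ ->] := hE _ si.
  + by rewrite tE; apply/mapP; exists i0.
Qed.
End FreeModule.

(** * Ideals, parts of polynomials and weights *)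
Lemma ideal_sum (R : comPzRingType) (I : ideal R) (T : eqType) (s : seq T)
    (P : pred T) (F : T -> R) :
  (forall i, i \in s -> P i -> I (F i)) -> I (\sum_(i <- s | P i) F i).
Proof.
move=> IF; rewrite big_seq_cond; elim/big_rec: _ => [|i x /andP[si Pi] Ix].
  exact: ideal0.
by apply: idealD => //; apply: IF.
Qed.

Lemma idealB (R : comPzRingType) (I : ideal R) x y : I x -> I y -> I (x - y).
Proof. by move=> Ix Iy; apply: idealD => //; rewrite -mulN1r; apply: idealM. Qed.

Lemma mem_gen (R : comPzRingType) (S : set R) x : S x -> gen S x.
Proof.
move=> Sx; exists [:: (1, x)]; last by rewrite big_seq1 mul1r.
by move=> c; rewrite inE => /eqP ->.
Qed.

Lemma gen_sub (R : comPzRingType) (S : set R) (I : ideal R) :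
  (forall x, S x -> I x) -> forall x, gen S x -> I x.
Proof.
move=> SI _ [s sS ->]; apply: ideal_sum => c /sS/SI Ic _; exact: idealM.
Qed.

Section Parts.
Variables (n : nat) (K : comNzRingType).
Implicit Types (P : pred (multinom n)) (p : mpoly n K).

Definition mpart P p : mpoly n K :=
  \sum_(a <- msupp p | P a) mcoeff a p *: mpolyX K a.

Lemma mcoeff_mpart P p b : mcoeff b (mpart P p) = if P b then mcoeff b p else 0.
Proof.
rewrite /mpart raddf_sum /=.
under eq_bigr => a _ do rewrite mcoeffZ mcoeffX.
have [bp|bp] := boolP (b \in msupp p); last first.
  rewrite (memN_msupp_eq0 bp) if_same big_seq_cond big1 // => a /andP[ap _].
  by case: eqP ap bp => [-> ->//|]; rewrite mulr0.
rewrite big_mkcond (bigD1_seq b) ?msupp_uniq //= eqxx mulr1.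
rewrite big1 ?addr0 // => a ab; case: ifP => // _.
by rewrite (negbTE ab) mulr0.
Qed.

Lemma msupp_mpart P p b : (b \in msupp (mpart P p)) = (b \in msupp p) && P b.
Proof.
by rewrite !mcoeff_msupp mcoeff_mpart; case: (P b); rewrite ?andbT // eqxx andbF.
Qed.

Lemma mpartB P : zmod_morphism (mpart P).
Proof.
move=> p q; apply/mpolyP=> b; rewrite mcoeffB !mcoeff_mpart mcoeffB.
by case: ifP; rewrite ?subr0.
Qed.
HB.instance Definition _ P := GRing.isZmodMorphism.Build _ _ (mpart P) (mpartB P).

Lemma mpartX P c b :
  mpart P (c *: mpolyX K b) = if P b then c *: mpolyX K b else 0.
Proof.
apply/mpolyP=> a; rewrite mcoeff_mpart.
have [->|ab] := eqVneq b a; first by case: ifP => _; rewrite ?mcoeff0.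
have ba0 : mcoeff a (c *: mpolyX K b) = 0.
  by rewrite mcoeffZ mcoeffX (negbTE ab) mulr0.
by case: (P b); rewrite ?mcoeff0 ba0 if_same.
Qed.

Lemma mpartMX P c a p : mpart P (c *: mpolyX K a * p) =
  c *: mpolyX K a * mpart (fun b => P (mnm_add a b)) p.
Proof.
rewrite [in LHS](mpolyE p) mulr_sumr raddf_sum /= /(mpart _ p) mulr_sumr.
rewrite [RHS]big_mkcond; apply: eq_bigr => b _ /=.
rewrite -scalerAl -scalerAr scalerA -mpolyXD mpartX.
by case: ifP => // _; rewrite -scalerAl -scalerAr scalerA -mpolyXD.
Qed.

Lemma mpart_split P p : p = mpart P p + mpart (predC P) p.
Proof.
apply/mpolyP=> b; rewrite mcoeffD !mcoeff_mpart /=.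
by case: (P b); rewrite ?addr0 ?add0r.
Qed.

Lemma ideal_mpoly (I : ideal (mpoly n K)) p :
  (forall a, a \in msupp p -> I (mpolyX K a)) -> I p.
Proof.
move=> Ip; rewrite (mpolyE p); apply: ideal_sum => a /Ip Ia _.
by rewrite -mul_mpolyC; apply: idealM.
Qed.
End Parts.

Section MinWeight.
Variables (D : realDomainType) (n : nat) (K : comNzRingType).
Implicit Types (w : 'rV[D]_n) (f : mpoly n K) (a b : multinom n).

Lemma expvD a b : expv D (mnm_add a b) = expv D a + expv D b.
Proof. by apply/rowP=> i; rewrite !mxE mnmDE natrD. Qed.

Lemma expv0 : expv D (mnm0 (n := n)) = 0.
Proof. by apply/rowP=> i; rewrite !mxE mnm0E. Qed.

Lemma expv_inj : injective (@expv D n).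
Proof.
move=> a b /rowP ab; apply/mnmP => i; have := ab i; rewrite !mxE => /eqP.
by rewrite eqr_nat => /eqP.
Qed.

Lemma dot_expvD w a b :
  dot w (expv D (mnm_add a b)) = dot w (expv D a) + dot w (expv D b).
Proof. by rewrite expvD dotDr. Qed.

Lemma dotDl (u v w : 'rV[D]_n) : dot (u + v) w = dot u w + dot v w.
Proof. by rewrite -big_split; apply: eq_bigr => i _; rewrite !mxE mulrDl. Qed.

Lemma dotZl c (u v : 'rV[D]_n) : dot (c *: u) v = c * dot u v.
Proof. by rewrite mulr_sumr; apply: eq_bigr => i _; rewrite !mxE mulrA. Qed.

Lemma le_min_weight w f x : (x%:E <= min_weight w f)%E <->
  (forall a, a \in msupp f -> x <= dot w (expv D a)).
Proof.
rewrite /min_weight; elim: (msupp f) => [|a s IH].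
  by rewrite big_nil leey.
rewrite big_cons le_min lee_fin; split=> [/andP[xa /IH xs] b|xs].
  by rewrite inE => /predU1P[->|/xs].
by rewrite xs ?mem_head //=; apply/IH => b bs; apply: xs; rewrite inE bs orbT.
Qed.

Lemma min_weight_attained w f : f <> 0 -> exists a, [/\ a \in msupp f,
  min_weight w f = (dot w (expv D a))%:E &
  forall b, b \in msupp f -> dot w (expv D a) <= dot w (expv D b)].
Proof.
move=> /eqP; rewrite -msupp_eq0 => f0.
have [a af wa] : exists2 a, a \in msupp f & min_weight w f = (dot w (expv D a))%:E.
  rewrite /min_weight; elim: (msupp f) f0 => // a s IH _.
  rewrite big_cons; case: (eqVneq s [::]) => [->|/IH[b bs ->]].
    by exists a; rewrite ?mem_head // big_nil minElt ltry.
  rewrite minElt; case: ifP => _; first by exists a; rewrite ?mem_head.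
  by exists b => //; rewrite inE bs orbT.
by exists a; split=> //; apply/le_min_weight; rewrite wa.
Qed.

Lemma in_wE w f : in_w w f =
  mpart (fun a => (dot w (expv D a))%:E == min_weight w f) f.
Proof. by []. Qed.

Lemma msupp_in_w w f b : b \in msupp (in_w w f) <-> b \in msupp f /\
  forall a, a \in msupp f -> dot w (expv D b) <= dot w (expv D a).
Proof.
rewrite in_wE msupp_mpart; split=> [/andP[bf /eqP bw]|[bf bw]].
  by split=> //; apply/le_min_weight; rewrite bw.
have f0 : f <> 0 by move=> f0; rewrite f0 (@msupp0 n K) in bf.
have [a [af -> aw]] := min_weight_attained w f0.
by rewrite bf eqe eq_le bw ?aw.
Qed.

Lemma in_w_neq0 w f : f <> 0 -> exists a, a \in msupp (in_w w f).
Proof.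
by move=> /(min_weight_attained w)[a [af _ aw]]; exists a; apply/msupp_in_w.
Qed.

Definition whomogeneous w f : Prop :=
  exists e, forall a, a \in msupp f -> dot w (expv D a) = e.

Lemma in_w_homogeneous w f : whomogeneous w (in_w w f).
Proof.
exists (fine (min_weight w f)) => a.
by rewrite in_wE msupp_mpart => /andP[_ /eqP <-].
Qed.

Definition wpart w e := mpart (K := K) (fun a => dot w (expv D a) == e).

(** A multiple of a homogeneous polynomial h by a monomial is homogeneous, so
    taking the part of weight e either keeps it or kills it; by linearity the
    parts of a combination of homogeneous generators are again such
    combinations. *)
Lemma gen_wpart w (S : set (mpoly n K)) : (forall f, S f -> whomogeneous w f) ->
  forall e f, gen S f -> gen S (wpart w e f).
Proof.
move=> Sw e _ [s sS ->]; rewrite /wpart raddf_sum; apply: (@ideal_sum _ (gen S)) => c /sS Sc _ /=.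
rewrite {1}(mpolyE c.1) mulr_suml raddf_sum; apply: (@ideal_sum _ (gen S)) => a _ _.
rewrite /= mpartMX; apply: (@idealM _ (gen S)).
have [e0 ce] := Sw _ Sc.
suff -> : mpart (fun b => dot w (expv D (mnm_add a b)) == e) c.2 =
    if dot w (expv D a) + e0 == e then c.2 else 0.
  by case: ifP => _; [apply: mem_gen|apply: ideal0].
apply/mpolyP=> b; rewrite mcoeff_mpart dot_expvD.
have [/ce ->|bc] := boolP (b \in msupp c.2); first by case: ifP; rewrite ?mcoeff0.
by do 2!case: ifP => _; rewrite ?mcoeff0 // memN_msupp_eq0.
Qed.
End MinWeight.

(** * The initial ideal of a class of weights *)
Section InitialIdeal.
Variables (K : closedFieldType) (R : realType) (n : nat).
Local Notation Kx := (mpoly n K).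
Local Notation wt w a := (dot w (expv R a)).
Variables (J : ideal Kx) (w0 : 'rV[R]_n).
Hypothesis hJ : weighted_homogeneous J.
Local Notation G := (groebner_class J w0).
Local Notation I := (in_w_ideal w0 J).
Hypothesis sep : forall a b : multinom n,
  (forall u, G u -> wt u a = wt u b) -> a = b.

Let in_eq u : G u -> forall f, in_w_ideal u J f <-> I f.
Proof. by move=> Gu f; rewrite -[in_w_ideal u J f]/(ideal_set _ f) Gu. Qed.

Lemma mem_in_w (u : 'rV[R]_n) f : J f -> in_w_ideal u J (in_w u f).
Proof. by move=> Jf; apply: mem_gen; exists f. Qed.

(** For two distinct monomials of f some weight of the class tells them
    apart, and I is homogeneous for that weight: the corresponding part of f is in
    I and has fewer terms. *)
Lemma in_ideal_monomial f : I f -> forall a, a \in msupp f -> I (mpolyX K a).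
Proof.
have [k] := ubnP (size (msupp f)); elim: k f => // k IH f fk If a af.
have [/allP fa|/allPn[b bf ba]] := boolP (all (pred1 a) (msupp f)).
  have -> : mpolyX K a = mpolyC n (mcoeff a f)^-1 * f.
    apply/mpolyP => b; rewrite mcoeffCM mcoeffX.
    have [<-|ab] := eqVneq a b; first by rewrite mulVf // -mcoeff_msupp.
    rewrite [mcoeff b f]memN_msupp_eq0 ?mulr0 //.
    by apply/negP => /fa /eqP ba; rewrite ba eqxx in ab.
  exact: idealM.
have [u Gu uab] : exists2 u, G u & wt u a != wt u b.
  apply: contrapT => Nu; move: ba => /=; rewrite eq_sym => /eqP; apply; apply: sep.
  by move=> u Gu; apply/eqP; apply: contrapT => /negP ab; apply: Nu; exists u.
pose g := wpart u (wt u a) f.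
apply: (IH g) => //; last by rewrite msupp_mpart af /=.
  rewrite ltnS in fk; apply: leq_trans fk.
  have ub : uniq (b :: msupp g).
    by rewrite cons_uniq msupp_uniq msupp_mpart eq_sym (negbTE uab) andbF.
  apply: (uniq_leq_size ub) => c; rewrite inE => /predU1P[->//|].
  by rewrite msupp_mpart => /andP[].
apply/(in_eq Gu); apply: gen_wpart; last by apply/(in_eq Gu).
by move=> _ [h _ <-]; apply: in_w_homogeneous.
Qed.

(** Normal forms: polynomials all of whose monomials are standard. *)
Definition standard_supported (q : Kx) : Prop :=
  forall b, b \in msupp q -> ~ I (mpolyX K b).
Local Notation std := standard_supported.

(** The initial form of a nonzero element of J has all its monomials in the
    monomial ideal I. *)
Lemma std_indep f : J f -> std f -> f = 0.
Proof.
move=> Jf sf; apply: contrapT => /(in_w_neq0 w0)[a af].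
apply: (sf a); first by case/msupp_in_w: af.
exact: in_ideal_monomial (mem_in_w w0 Jf) _ af.
Qed.

Lemma std_add f g : std f -> std g -> std (f + g).
Proof. by move=> sf sg b /msuppD_le; rewrite mem_cat => /orP[/sf|/sg]. Qed.

Lemma std_scale c f : std f -> std (c *: f).
Proof. by move=> sf b /msuppZ_le/sf. Qed.

Lemma std_sum (T : eqType) (s : seq T) (F : T -> Kx) :
  (forall i, i \in s -> std (F i)) -> std (\sum_(i <- s) F i).
Proof.
move=> sF; rewrite big_seq; elim/big_rec: _ => [b|i x /sF si sx].
  by rewrite (@msupp0 n K).
exact: std_add.
Qed.

Section Reduction.
Variable d : 'I_n -> nat.
Hypothesis d_gt0 : forall i, (0 < d i)%N.
Variable S : set Kx.
Hypothesis Sd : forall f, S f -> homogeneous d f.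
Hypothesis JS : ideal_set J = ideal_set (gen S).

Let dv : 'rV[R]_n := \row_i (d i)%:R.

Let wt_dv a : wt dv a = (\sum_i d i * a i)%:R.
Proof. by rewrite natr_sum; apply: eq_bigr => i _; rewrite !mxE natrM. Qed.

Lemma ideal_wpart e f : J f -> J (wpart dv e f).
Proof.
rewrite -![J _]/(ideal_set J _) JS; apply: gen_wpart => g /Sd[k gk].
by exists k%:R => a /gk; rewrite wt_dv => ->.
Qed.

(** The bihomogeneous parts of g for the positive grading and for the weight
    [w0] are initial parts of elements of J.  An element of I is a combination
    of initial forms and need not be one itself, but the property is stable
    under such combinations. *)
Definition lifts_parts (g : Kx) : Prop := forall e D : R, exists f,
  [/\ J f, forall a, a \in msupp f -> wt dv a = D /\ e <= wt w0 a &
      forall a, wt dv a = D -> wt w0 a = e -> mcoeff a f = mcoeff a g].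

Lemma in_ideal_lifts_parts g : I g -> lifts_parts g.
Proof.
have lp0 : lifts_parts 0.
  by move=> e D; exists 0; split=> //; [exact: ideal0|move=> a; rewrite (@msupp0 n K)].
have lpD g1 g2 : lifts_parts g1 -> lifts_parts g2 -> lifts_parts (g1 + g2).
  move=> l1 l2 e D; have [f1 [J1 s1 c1]] := l1 e D; have [f2 [J2 s2 c2]] := l2 e D.
  exists (f1 + f2); split; first exact: idealD.
    by move=> a /msuppD_le; rewrite mem_cat => /orP[/s1|/s2].
  by move=> a aD ae; rewrite !mcoeffD c1 ?c2.
have lpX c b g1 : lifts_parts g1 -> lifts_parts (c *: mpolyX K b * g1).
  move=> l1 e D; have [f [Jf sf cf]] := l1 (e - wt w0 b) (D - wt dv b).
  exists (c *: mpolyX K b * f); split; first exact: idealM.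
    move=> a; rewrite -scalerAl mulrC => /msuppZ_le; rewrite (perm_mem (msuppMX _ _)).
    move=> /mapP[a' /sf[aD ae] ->]; rewrite !dot_expvD aD.
    by rewrite addrC subrK -lerBlDl.
  move=> a aD ae; rewrite -!scalerAl !mcoeffZ ![mpolyX K b * _]mulrC.
  congr (_ * _); have [ba|ba] := boolP (lem b a).
    rewrite -(submK ba) addmC !mcoeffMX cf //; apply/eqP.
      by rewrite eq_sym subr_eq -dot_expvD submK // aD.
    by rewrite eq_sym subr_eq -dot_expvD submK // ae.
  rewrite !memN_msupp_eq0 ?(perm_mem (msuppMX _ _)) //; apply/mapP => -[a' _ aE];
    by rewrite aE lem_addr in ba.
have lpI f : J f -> lifts_parts (in_w w0 f).
  move=> Jf e D; have [fe|fe] := eqVneq (min_weight w0 f) e%:E; last first.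
    exists 0; split; first exact: ideal0.
      by move=> a; rewrite (@msupp0 n K).
    by move=> a _ ae; rewrite mcoeff0 in_wE mcoeff_mpart ae eq_sym (negbTE fe).
  exists (wpart dv D f); split; first exact: ideal_wpart.
    move=> a; rewrite msupp_mpart => /andP[af /eqP ->]; split=> //.
    by move: a af; apply/le_min_weight; rewrite fe.
  by move=> a aD ae; rewrite in_wE !mcoeff_mpart aD ae fe !eqxx.
case=> s sI ->; rewrite big_seq; elim/big_rec: _ => // c x cs lx.
apply: (lpD) => //; rewrite (mpolyE c.1) mulr_suml.
have [f Jf <-] := sI _ cs.
by elim/big_rec: _ => // a y _ ly; apply: lpD => //; apply/lpX/lpI.
Qed.

(** A monomial of I is the initial form of some f in J homogeneous for the
    positive grading; subtracting f replaces it by monomials of the same degree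
    and larger weight.  There are finitely many monomials of that degree, hence
    the termination. *)
Lemma std_reduce_monomial a : exists2 q, std q & J (mpolyX K a - q).
Proof.
pose D := (\sum_i d i * a i)%N.
(* Positivity of d bounds the degrees of the monomials c by D. *)
pose above b := [pred c : bmultinom n D.+1 | wt w0 b < wt w0 c].
suff H k b : wt dv b = D%:R -> (#|above b| < k)%N ->
    exists2 q, std q & J (mpolyX K b - q) by apply: H (wt_dv a) (ltnSn _).
elim: k b => // k IH b bD bk.
have [Ib|Ib] := pselect (I (mpolyX K b)); last first.
  exists (mpolyX K b); last by rewrite subrr; apply: ideal0.
  by move=> c; rewrite msuppX inE => /eqP ->.
have [f [Jf sf cf]] := in_ideal_lifts_parts Ib (wt w0 b) D%:R.
have fb : mcoeff b f = 1 by rewrite cf // mcoeffX eqxx.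
have /boolp.choice[q qE] c : exists q, c \in msupp f -> c != b ->
    std q /\ J (mpolyX K c - q).
  have [cf'|] := boolP (c \in msupp f); last by exists 0.
  have [cb|cb] := eqVneq c b; first by exists 0.
  have [cD cw] := sf _ cf'.
  have {}cw : wt w0 b < wt w0 c.
    rewrite lt_neqAle cw andbT; apply/eqP => bc.
    have := cf _ cD (esym bc); rewrite mcoeffX eq_sym (negbTE cb) => fc0.
    by move: cf'; rewrite mcoeff_msupp fc0 eqxx.
  have [||q' sq' Jq'] := IH c; [by []| |by exists q'].
  rewrite ltnS in bk; apply: leq_trans bk; apply: proper_card.
  apply/properP; split.
    by apply/fintype.subsetP => z; rewrite !inE; apply: lt_trans cw.
  have cdeg : (mdeg c < D.+1)%N.
    move: cD; rewrite wt_dv => /eqP; rewrite eqr_nat ltnS => /eqP <-.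
    by rewrite mdegE leq_sum // => i _; rewrite leq_pmull.
  by exists (BMultinom cdeg); rewrite !inE /= ?cw ?ltxx.
exists (- \sum_(c <- rem b (msupp f)) mcoeff c f *: q c).
  rewrite -scaleN1r; apply/std_scale/std_sum => c; rewrite mem_rem_uniq ?msupp_uniq //.
  by rewrite inE => /andP[cb /qE/(_ cb)[sq _]]; apply: std_scale.
have bf : b \in msupp f by rewrite mcoeff_msupp fb oner_neq0.
have -> : mpolyX K b - - \sum_(c <- rem b (msupp f)) mcoeff c f *: q c =
    f - \sum_(c <- rem b (msupp f)) mcoeff c f *: (mpolyX K c - q c).
  have fE : f = mpolyX K b + \sum_(c <- rem b (msupp f)) mcoeff c f *: mpolyX K c.
    by rewrite [LHS]mpolyE (perm_big _ (perm_to_rem bf)) big_cons fb scale1r.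
  under [X in _ = _ - X]eq_bigr => c _ do rewrite scalerBr.
  by rewrite [X in _ = X - _]fE opprK sumrB opprB addrACA subrr addr0.
apply: idealB => //; apply: ideal_sum => c; rewrite mem_rem_uniq ?msupp_uniq //.
rewrite inE => /andP[cb /qE/(_ cb)[_ Jq]] _.
by rewrite -mul_mpolyC; apply: idealM.
Qed.
End Reduction.

Lemma std_nf_monomial a : exists2 q, std q & J (mpolyX K a - q).
Proof. by have [d d0 [S Sd JS]] := hJ; exact: (std_reduce_monomial d0 Sd JS a). Qed.

Lemma std_nf p : exists2 q, std q & J (p - q).
Proof.
have /boolp.choice[q qE] a : exists q, std q /\ J (mpolyX K a - q).
  by have [q] := std_nf_monomial a; exists q.
exists (\sum_(a <- msupp p) mcoeff a p *: q a).
  by apply: std_sum => a _; apply: std_scale; have [] := qE a.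
rewrite {1}(mpolyE p) -sumrB; apply: ideal_sum => a _ _.
by rewrite -scalerBr -mul_mpolyC; apply: idealM; have [] := qE a.
Qed.

(** The inequalities that cut out the class: replacing a monomial of I by its
    normal form increases the weight. *)
Definition raises_weight (w : 'rV[R]_n) : Prop := forall a q,
  I (mpolyX K a) -> std q -> J (mpolyX K a - q) ->
  forall b, b \in msupp q -> wt w a < wt w b.

Lemma nf_support a (q : Kx) c :
  c \in msupp (mpolyX K a - q) -> c = a \/ c \in msupp q.
Proof.
by move=> /msuppB_le; rewrite mem_cat msuppX inE => /orP[/eqP|]; [left|right].
Qed.

Lemma nf_coef a q : I (mpolyX K a) -> std q -> mcoeff a (mpolyX K a - q) = 1.
Proof.
move=> Ia sq; rewrite mcoeffB mcoeffX eqxx memN_msupp_eq0 ?subr0 //.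
by apply/negP => /sq.
Qed.

(** The initial form of x^a - q lies in I, and x^a is the only monomial
    of x^a - q that does. *)
Lemma class_raises_weight u : G u -> raises_weight u.
Proof.
move=> Gu a q Ia sq Jf b bq; set f := mpolyX K a - q in Jf.
have f0 : f <> 0.
  move=> f0; have := nf_coef Ia sq; rewrite -/f f0 mcoeff0 => /eqP.
  by rewrite eq_sym oner_eq0.
have only_a c : c \in msupp (in_w u f) -> c = a.
  move=> cf; have Ic : I (mpolyX K c).
    by apply: (in_ideal_monomial _ cf); apply/(in_eq Gu)/mem_in_w.
  have [cf' _] := (msupp_in_w u f c).1 cf.
  by have [//|/sq] := nf_support cf'.
have [c cf] := in_w_neq0 u f0.
have ca := only_a _ cf; rewrite {c}ca in cf.
have [_ amin] := (msupp_in_w u f a).1 cf.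
have bf : b \in msupp f.
  rewrite mcoeff_msupp mcoeffB mcoeffX; have [ab|_] := eqVneq a b.
    by case: (sq _ bq); rewrite -ab.
  by rewrite sub0r oppr_eq0 -mcoeff_msupp.
rewrite lt_neqAle amin // andbT; apply/eqP => ab.
suff /only_a ba : b \in msupp (in_w u f) by case: (sq _ bq); rewrite ba.
by apply/msupp_in_w; split=> // c /amin; rewrite ab.
Qed.

(** For one inclusion, x^a is the initial form of x^a - q.  For the other,
    reducing the monomials of g that lie in I must cancel all the standard ones,
    since g is in J; so a standard monomial of g occurs in the normal form of a
    monomial of g of smaller weight, and is not in the initial form. *)
Lemma raises_weight_class w : raises_weight w -> G w.
Proof.
move=> rw; apply/seteqP; split=> f.
  apply: gen_sub => _ [g Jg <-]; apply: ideal_mpoly => c cg.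
  apply: contrapT => Ic; have [cg' cmin] := (msupp_in_w w g c).1 cg.
  have /boolp.choice[q qE] a : exists q, std q /\ J (mpolyX K a - q).
    by have [q] := std_nf_monomial a; exists q.
  pose nonstd a := `[< I (mpolyX K a) >].
  (* the normal form of g *)
  pose h := mpart (predC nonstd) g + \sum_(a <- msupp g | nonstd a) mcoeff a g *: q a.
  have h0 : h = 0.
    apply: std_indep.
      have -> : h = g - \sum_(a <- msupp g | nonstd a) mcoeff a g *: (mpolyX K a - q a).
        under [X in _ - X]eq_bigr => a _ do rewrite scalerBr.
        rewrite sumrB opprB [X in _ = X + _](mpart_split nonstd g).
        by rewrite [RHS]addrC [RHS]addrA subrK addrC.
      apply: idealB => //; apply: ideal_sum => a _ _.
      by rewrite -mul_mpolyC; apply: idealM; have [] := qE a.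
    apply: std_add.
      by move=> b; rewrite msupp_mpart /= => /andP[_ /asboolPn].
    rewrite -big_filter; apply: std_sum => a _; apply: std_scale.
    by have [] := qE a.
  have : mcoeff c h = 0 by rewrite h0 mcoeff0.
  rewrite mcoeffD mcoeff_mpart /= ifT; last exact/asboolPn.
  apply/eqP; rewrite raddf_sum big_seq_cond big1 /=.
    by rewrite addr0 -mcoeff_msupp.
  move=> a /andP[ag /asboolP Ia]; rewrite mcoeffZ; apply/eqP.
  rewrite mulf_eq0 orbC mcoeff_eq0; apply/orP; left; apply/negP => ca.
  have [sq Jq] := qE a.
  by have := rw _ _ Ia sq Jq _ ca; rewrite ltNge cmin.
move=> If; apply: ideal_mpoly => a /(in_ideal_monomial If) Ia.
have [q sq Jq] := std_nf_monomial a.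
suff -> : mpolyX K a = in_w w (mpolyX K a - q) by apply: mem_in_w.
set g := mpolyX K a - q.
have ag : a \in msupp g by rewrite mcoeff_msupp nf_coef ?oner_neq0.
apply/mpolyP=> c; have [->|ca] := eqVneq c a.
  have aw : a \in msupp (in_w w g).
    apply/msupp_in_w; split=> // b /nf_support[->//|bq].
    exact/ltW/(rw _ _ Ia sq Jq).
  move: aw; rewrite in_wE msupp_mpart mcoeff_mpart => /andP[_ ->].
  by rewrite mcoeffX eqxx nf_coef.
rewrite mcoeffX eq_sym (negbTE ca) memN_msupp_eq0 //; apply/negP.
move=> /msupp_in_w[/nf_support[cE|cq] cmin]; first by rewrite cE eqxx in ca.
by have := rw _ _ Ia sq Jq _ cq; rewrite ltNge cmin.
Qed.

Lemma class_add u v : G u -> G v -> G (u + v).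
Proof.
move=> /class_raises_weight Gu /class_raises_weight Gv.
apply: raises_weight_class => a q Ia sq Jq b bq.
by rewrite !dotDl ltrD ?(Gu a q) ?(Gv a q).
Qed.

Lemma class_scale c u : 0 < c -> G u -> G (c *: u).
Proof.
move=> c0 /class_raises_weight Gu; apply: raises_weight_class.
by move=> a q Ia sq Jq b bq; rewrite !dotZl ltr_pM2l // (Gu a q).
Qed.
End InitialIdeal.

(** * Closed convex cones of full dimension *)
Section ConvexCone.
Variables (R : realType) (n : nat).
Local Notation V := 'rV[R]_n.
Implicit Types (u v w x y : V).

Lemma dot_continuous v : continuous (fun w => dot w v).
Proof.
move=> w; rewrite /continuous_at /dot.
have FF : Filter (nbhs w) := nbhs_filter w.
have H (s : seq 'I_n) : (fun z : V => \sum_(i <- s) z 0 i * v 0 i) @ w -->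
    \sum_(i <- s) w 0 i * v 0 i.
  elim: s => [|i s IH].
    have -> : (fun z : V => \sum_(i <- [::]) z 0 i * v 0 i) = fun=> 0.
      by apply: funext => z; rewrite big_nil.
    by rewrite big_nil; apply: cvg_cst.
  have -> : (fun z : V => \sum_(j <- i :: s) z 0 j * v 0 j) =
      (fun z : V => z 0 i * v 0 i + \sum_(j <- s) z 0 j * v 0 j).
    by apply: funext => z; rewrite big_cons.
  rewrite big_cons.
  apply: cvgD IH; apply: cvgM; last exact: cvg_cst.
  exact: coord_continuous.
exact: H.
Qed.

Lemma dot_gt_near w v c : c < dot w v -> \forall z \near w, c < dot z v.
Proof.
have FF : Filter (nbhs w) := nbhs_filter w.
move=> cw; exact: (@cvgr_gt R V (nbhs w) FF _ _ (@dot_continuous v w) c cw).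
Qed.

Lemma dot_lt_near w v c : dot w v < c -> \forall z \near w, dot z v < c.
Proof.
have FF : Filter (nbhs w) := nbhs_filter w.
move=> cw; exact: (@cvgr_lt R V (nbhs w) FF _ _ (@dot_continuous v w) c cw).
Qed.

Lemma closure_halfspace (G : set V) v : (forall u, G u -> 0 <= dot u v) ->
  forall u, closure G u -> 0 <= dot u v.
Proof.
move=> Gv u Gu; rewrite leNgt; apply/negP => /dot_lt_near /Gu[z [/Gv]].
by rewrite leNgt => /negP.
Qed.

Variable G : set V.
Hypothesis GD : forall u v, G u -> G v -> G (u + v).
Hypothesis GZ : forall (c : R) u, 0 < c -> G u -> G (c *: u).
Local Notation C := (closure G).

Lemma closureD u v : C u -> C v -> C (u + v).
Proof.
move=> Cu Cv B /(add_continuous (u, v))[[Bu Bv] /= [nu nv] sB].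
have [[x [Gx Bx]] [y [Gy By]]] := (Cu _ nu, Cv _ nv).
by exists (x + y); split; [exact: GD|exact: (sB (x, y))].
Qed.

Lemma closureZ (c : R) u : 0 < c -> C u -> C (c *: u).
Proof.
move=> c0 Cu B /(@scaler_continuous _ _ c u) /Cu[x [Gx Bx]].
by exists (c *: x); split; [exact: GZ|].
Qed.

Variable M : 'M[R]_n.
Hypotheses (Mu : M \in unitmx) (MC : forall i, C (row i M)).

(** The invertible matrix M has its rows in the cone, so that the translates
    by its points of the open simplicial cone on these rows stay in it. *)
Lemma closure_orthant x y : C x ->
  (forall j, 0 < ((y - x) *m invmx M) 0 j) -> C y.
Proof.
move=> Cx xy; rewrite -[y](subrK x) addrC -[y - x](mulmxKV Mu) mulmx_sum_row.
move: {xy}(_ *m _) (xy) => c c0.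
elim/big_rec: _ x Cx => [x|j z _ IH x] Cx; first by rewrite addr0.
by rewrite addrA; apply: IH; apply: closureD => //; apply: closureZ.
Qed.

Lemma orthant_dot z j : (z *m invmx M) 0 j = dot z (\row_k invmx M k j).
Proof. by rewrite mxE; apply: eq_bigr => k _; rewrite !mxE. Qed.

Lemma closure_orthant_near x y : C x ->
  (forall j, 0 < ((y - x) *m invmx M) 0 j) -> nbhs y C.
Proof.
move=> Cx xy.
have FF : Filter (nbhs y) := nbhs_filter y.
have dotB z j : ((z - x) *m invmx M) 0 j =
    dot z (\row_k invmx M k j) - dot x (\row_k invmx M k j).
  by rewrite -!orthant_dot mulmxBl !mxE.
suff : \forall z \near y, forall j, 0 < ((z - x) *m invmx M) 0 j.
  by apply: filterS => z; apply: closure_orthant.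
apply: (@filter_forall _ _ _ (nbhs y) FF) => j; have := xy j; rewrite dotB subr_gt0.
by move=> /dot_gt_near; apply: filterS => z; rewrite dotB subr_gt0.
Qed.

(** A point of the open simplicial cone on the rows of M. *)
Definition row_sum : V := const_mx 1 *m M.

Lemma row_sum_near x c : C x -> 0 < c -> nbhs (x + c *: row_sum) C.
Proof.
move=> Cx c0; apply: (closure_orthant_near Cx) => j.
by rewrite addrC addKr -scalemxAl mulmxK // !mxE mulr1.
Qed.

(** If v is negative at w in C, it is still negative on a small ball around
    w + e * row_sum, and this ball lies in C.  The rounding of a large multiple of
    its centre is then a lattice point of C where v is negative. *)
Lemma lattice_dual v :
    (forall k : 'rV[int]_n, C (zvec R k) -> 0 <= dot (zvec R k) v) ->
  dual_cone C v.
Proof.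
move=> Cv w Cw; rewrite leNgt; apply/negP => wv.
(* e is small enough for v to stay negative at w + e * row_sum *)
pose s := dot row_sum v; pose e := - dot w v / (2 * (1 + `|s|)).
have s1 : 0 < 1 + `|s| by rewrite ltr_pwDl.
have e0 : 0 < e by rewrite divr_gt0 ?oppr_gt0 ?mulr_gt0.
have ev : dot (w + e *: row_sum) v < 0.
  have eE : e * (1 + `|s|) = - dot w v / 2.
    by rewrite /e; field; rewrite gt_eqF.
  have : e * s <= e * `|s| by rewrite ler_pM2l // ler_norm.
  rewrite dotDl dotZl -/s; nra.
set y := w + e *: row_sum in ev.
have /nbhs_ballP[d /= d0 yd] : nbhs y (C `&` [set z | dot z v < 0]).
  by apply: filterI; [apply: row_sum_near|apply: dot_lt_near].
clearbody y; pose N := (Num.bound d^-1).+1.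
have N0 : 0 < N%:R :> R by rewrite ltr0n.
have Nd : N%:R^-1 < d.
  rewrite invf_plt ?posrE // /N -natr1.
  by apply: lt_trans (archi_boundP _) _; rewrite ?invr_ge0 ?(ltW d0) ?ltrDl.
pose k : 'rV[int]_n := \row_i Num.floor (N%:R * y 0 i).
have [Ck kv] : (C `&` [set z | dot z v < 0]) (N%:R^-1 *: zvec R k).
  apply: yd; split=> // i j; rewrite ord1 /ball /= !mxE.
  set t := y 0 j; have tE : t = N%:R^-1 * (N%:R * t) by rewrite mulKf ?gt_eqF.
  rewrite [X in X - _]tE -mulrBr normrM gtr0_norm ?invr_gt0 //.
  apply: le_lt_trans Nd; rewrite ger_pMr ?invr_gt0 //.
  have := floor_le (N%:R * t); have := ltW (floorD1_gt (N%:R * t)).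
  by rewrite intrD => h1 h2; rewrite ger0_norm ?subr_ge0 // lerBlDl.
have kC : C (zvec R k).
  have := closureZ N0 Ck; rewrite scalerA mulfV ?scale1r ?gt_eqF //.
have := Cv _ kC; rewrite leNgt => /negP; apply.
move: kv; rewrite /= dotZl pmulr_rlt0 // invr_gt0 //.
Qed.
End ConvexCone.

(** * Standard monomials of a maximal cone *)
Section StandardMonomials.
Variables (K : closedFieldType) (R : realType) (n : nat).
Local Notation Kx := (mpoly n K).

(** A vector orthogonal to the class is orthogonal to its closure, hence to a
    basis. *)
Lemma full_dimensional_sep (G : set 'rV[R]_n) : full_dimensional (closure G) ->
  forall a b : multinom n,
  (forall u, G u -> dot u (expv R a) = dot u (expv R b)) -> a = b.
Proof.
case=> M Mu MC a b ab; apply/(@expv_inj R)/eqP; rewrite -subr_eq0; apply/eqP.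
set v := expv R a - expv R b.
have Gv u : G u -> dot u v = 0 by move=> /ab uab; rewrite dotDr dotNr uab subrr.
have Cv u : closure G u -> dot u v = 0.
  move=> Cu; apply/eqP; rewrite eq_le; apply/andP; split.
    rewrite -oppr_ge0 -dotNr; apply: closure_halfspace Cu => z /Gv zv.
    by rewrite dotNr zv oppr0.
  by apply: closure_halfspace Cu => z /Gv ->.
have Mv : M *m v^T = 0.
  apply/matrixP => i j; rewrite !mxE -[RHS](Cv _ (MC i)).
  by apply: eq_bigr => k _; rewrite !mxE.
by apply: trmx_inj; rewrite trmx0 -(mulKmx Mu v^T) Mv mulmx0.
Qed.

(** What the two families need from the cone: standard monomials are
    independent and generate modulo J, normal forms do not lower any weight of
    C, and the lattice points of C suffice to test the dual cone. The interior
    of C is open and nonempty, so it meets the class of which C is the closure;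
    at a common point the compatibility identifies the initial ideal of the
    class with that of the term order. *)
Lemma standard_monomials (J : ideal Kx) (C : set 'rV[R]_n)
    (le : rel (multinom n)) :
    weighted_homogeneous J -> maximal_cone J C -> compatible J C le ->
  [/\ forall f, J f -> (forall a, a \in msupp f -> standard J le a) -> f = 0,
      forall p, exists2 q, (forall a, a \in msupp q -> standard J le a) & J (p - q),
      forall a q, (forall b, b \in msupp q -> standard J le b) ->
        J (mpolyX K a - q) -> forall w, C w -> forall b, b \in msupp q ->
        dot w (expv R a) <= dot w (expv R b) &
      forall v, (forall k : 'rV[int]_n, C (zvec R k) -> 0 <= dot (zvec R k) v) ->
        dual_cone C v].
Proof.
move=> hJ [[w0 _ <-] _ [M Mu MC]]; set G := groebner_class J w0 => hcomp.
have hsep := full_dimensional_sep (ex_intro2 _ _ M Mu MC).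
have GD := class_add hJ hsep; have GZ := class_scale hJ hsep.
have GC u : G u -> closure G u by apply: subset_closure.
have [u [Gu iu]] : exists u, G u /\ interior (closure G) u.
  have nb := row_sum_near GD GZ Mu MC (GC w0 erefl) ltr01.
  have [u [Gu iu]] := nbhs_singleton nb _ (nbhs_interior nb).
  by exists u.
have leE : ideal_set (in_le_ideal le J) = ideal_set (in_w_ideal w0 J).
  by rewrite (hcomp _ iu) Gu.
have stE a : standard J le a <-> ~ in_w_ideal w0 J (mpolyX K a).
  by rewrite -[in_w_ideal w0 J _]/(ideal_set (in_w_ideal w0 J) _) -leE.
have st q : (forall a, a \in msupp q -> standard J le a) ->
    standard_supported J w0 q by move=> sq a /sq/stE.
split.
- by move=> f Jf /st; apply: std_indep hsep _ Jf.
- by move=> p; have [q sq Jq] := std_nf w0 hJ p; exists q => // a /sq/stE.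
- move=> a q /st sq Jq w Cw b bq.
  have [Ia|Ia] := pselect (in_w_ideal w0 J (mpolyX K a)).
    rewrite -subr_ge0 -dotNr -dotDr; apply: closure_halfspace Cw => z Gz.
    rewrite dotDr dotNr subr_ge0; apply: ltW.
    exact: (class_raises_weight hsep Gz Ia sq Jq).
  have : mpolyX K a - q = 0.
    apply: (std_indep hsep Jq); apply: std_add.
      by move=> c; rewrite msuppX inE => /eqP ->.
    by rewrite -scaleN1r; apply: std_scale.
  move/eqP; rewrite subr_eq0 => /eqP aq.
  by move: bq; rewrite -aq msuppX inE => /eqP ->.
- by move=> v; apply: (lattice_dual GD GZ Mu MC).
Qed.
End StandardMonomials.

(** * Group rings and Laurent polynomials *)
Section GroupRingCoefs.
Variables (A : comPzRingType) (M : zmodType).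
Implicit Types (g : group_ring A M) (k l : M).

Lemma gcoef_mul_term g b l k : gcoef k (g * gterm b l) = gcoef (k - l) g * b.
Proof.
rewrite gmulE [in LHS](group_ringE g) [in RHS](group_ringE g) gmul_suml.
rewrite !raddf_sum mulr_suml; apply: eq_bigr => j _ /=.
by rewrite gmul_term !gcoef_term mulrnAl [j == _]eq_sym subr_eq [k == _]eq_sym.
Qed.

Lemma gtermM (a b : A) k l : gterm a k * gterm b l = gterm (a * b) (k + l).
Proof. by rewrite gmulE gmul_term. Qed.

Lemma gterm_sum (T : Type) (s : seq T) (F : T -> A) k :
  gterm (\sum_(i <- s) F i) k = \sum_(i <- s) gterm (F i) k.
Proof. exact: (big_morph (fun x : A => gterm x k) (gtermD k) (gterm0 A k)). Qed.

Lemma group_ring_const (B : comPzRingType) (h : {rmorphism B -> A}) :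
  exists c : {rmorphism B -> group_ring A M}, forall b, c b = gterm (h b) 0.
Proof.
have [||c cE] := @rmorphism_of_fun B (group_ring A M) (fun b => gterm (h b) 0); last by exists c.
  move=> x y; rewrite rmorphB; apply: (addIr (gterm (h y) 0)).
  by rewrite -gtermD !subrK.
by split=> [|x y]; rewrite ?rmorph1 // rmorphM gtermM addr0.
Qed.

Lemma group_ring_coef_map (B : comPzRingType) (h : {rmorphism A -> B}) :
  exists G : {rmorphism group_ring A M -> group_ring B M},
  (forall a k, G (gterm a k) = gterm (h a) k) /\
  (forall g k, gcoef k (G g) = h (gcoef k g)).
Proof.
have [G GE] := @group_ring_map A B M M h id (fun _ _ => erefl).
exists G; split=> // g k; rewrite [g in LHS]group_ringE [g in RHS]group_ringE.
rewrite !raddf_sum; apply: eq_bigr => j _ /=.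
by rewrite GE !gcoef_term raddfMn.
Qed.
End GroupRingCoefs.

(** Extension of scalars A[M] -> B[M]. *)
Definition gcoef_map (A B : comPzRingType) (M : zmodType) (h : {rmorphism A -> B}) :
  {rmorphism group_ring A M -> group_ring B M} :=
  sval (cid (group_ring_coef_map M h)).

Section GcoefMap.
Variables (A B : comPzRingType) (M : zmodType) (h : {rmorphism A -> B}).

Lemma gcoef_map_term a k : gcoef_map M h (gterm a k) = gterm (h a) k.
Proof. by rewrite /gcoef_map; case: cid => G [? ?] /=. Qed.

Lemma gcoef_gcoef_map g k : gcoef k (gcoef_map M h g) = h (gcoef k g).
Proof. by rewrite /gcoef_map; case: cid => G [? ?] /=. Qed.
End GcoefMap.

Section Laurent.
Variables (K : comNzRingType) (m : nat).

Lemma laurent_morphism_ex : exists L : {rmorphism mpoly m K -> group_ring K 'rV[int]_m},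
  forall c b, L (c *: mpolyX K b) = gterm c (expv int b).
Proof.
have [t tE] := group_ring_const 'rV[int]_m (idfun : {rmorphism K -> K}).
have [||L LE] := @poly_extension m K _ t (fun b => gterm 1 (expv int b)).
- by rewrite expv0.
- by move=> a b; rewrite gtermM mulr1 expvD.
by exists L => c b; rewrite LE tE gtermM mulr1 add0r.
Qed.

(** The inclusion of the polynomials in m variables into K[Z^m]. *)
Definition laurent := sval (cid laurent_morphism_ex).

Lemma laurentX c b : laurent (c *: mpolyX K b) = gterm c (expv int b).
Proof. by rewrite /laurent; case: cid. Qed.

Lemma gcoef_laurent p b : gcoef (expv int b) (laurent p) = mcoeff b p.
Proof.
rewrite [in LHS](mpolyE p) [in RHS](mpolyE p) !raddf_sum; apply: eq_bigr => a _ /=.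
rewrite laurentX gcoef_term mcoeffZ mcoeffX (inj_eq (@expv_inj _ _)).
by rewrite mulr_natr.
Qed.

Lemma laurent_inj : injective laurent.
Proof. by move=> p q pq; apply/mpolyP => b; rewrite -!gcoef_laurent pq. Qed.
End Laurent.

(** * The filtration of the quasivaluation *)
Section Families.
Variables (K : closedFieldType) (R : realType) (n : nat).
Local Notation Kx := (mpoly n K).
Local Notation Zn := 'rV[int]_n.
Variables (J : ideal Kx) (C : set 'rV[R]_n) (le : rel (multinom n)).
Local Notation st := (standard J le).
Local Notation std q := (forall a, a \in msupp q -> st a).
Hypothesis st_indep : forall f : Kx, J f -> std f -> f = 0.
Hypothesis st_nf : forall p : Kx, exists2 q, std q & J (p - q).
Hypothesis nf_raises : forall a q, std q -> J (mpolyX K a - q) ->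
  forall w, C w -> forall b, b \in msupp q -> dot w (expv R a) <= dot w (expv R b).
Hypothesis lattice_test : forall v,
  (forall k : Zn, C (zvec R k) -> 0 <= dot (zvec R k) v) -> dual_cone C v.

Local Notation A := (quot_ring J).
Local Notation S := (@toric_monoid R n C).

Definition bar (a : multinom n) : A := quot_proj J (mpolyX K a).

Lemma barD a b : bar (mnm_add a b) = bar a * bar b.
Proof. by rewrite /bar mpolyXD rmorphM. Qed.

Lemma bar0 : bar (mnm0 (n := n)) = 1.
Proof. by rewrite /bar mpolyX0 rmorph1. Qed.

Lemma bar_inj a b : st a -> st b -> bar a = bar b -> a = b.
Proof.
move=> sa sb /quot_projP Jab.
have : mpolyX K a - mpolyX K b = 0.
  apply: st_indep Jab _ => c /msuppB_le; rewrite mem_cat !msuppX !inE.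
  by case/orP=> /eqP ->.
move/(congr1 (mcoeff a)); rewrite mcoeffB !mcoeffX eqxx mcoeff0.
by case: eqP => [-> //|_] /eqP; rewrite subr0 oner_eq0.
Qed.

Definition cst : {rmorphism K -> A} := quot_proj J \o @mpolyC n K.

Lemma quot_proj_cst p : quot_proj J p = \sum_(a <- msupp p) cst (mcoeff a p) * bar a.
Proof.
rewrite {1}(mpolyE p) raddf_sum; apply: eq_bigr => a _.
by rewrite -mul_mpolyC /= rmorphM.
Qed.

Lemma std_nf_linear (q : multinom n -> Kx) p p' :
    (forall a, std (q a) /\ J (mpolyX K a - q a)) -> std p' -> J (p - p') ->
  p' = \sum_(a <- msupp p) mcoeff a p *: q a.
Proof.
move=> qE sp' Jp; apply/eqP; rewrite -subr_eq0; apply/eqP/st_indep.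
  rewrite -opprB -mulN1r; apply: idealM.
  have -> : \sum_(a <- msupp p) mcoeff a p *: q a - p' =
      p - p' - \sum_(a <- msupp p) mcoeff a p *: (mpolyX K a - q a).
    under [X in _ - X]eq_bigr => a _ do rewrite scalerBr.
    by rewrite sumrB -mpolyE opprB [RHS]addrC [RHS]addrA subrK.
  apply: idealB => //; apply: ideal_sum => a _ _.
  by rewrite -mul_mpolyC; apply: idealM; have [] := qE a.
move=> b /msuppB_le; rewrite mem_cat => /orP[/sp'//|].
rewrite mcoeff_msupp raddf_sum /= => nz; apply: contrapT => nb.
case/negP: nz; rewrite big1 // => a _; rewrite mcoeffZ [mcoeff b _]memN_msupp_eq0 ?mulr0 //.
by apply/negP => /(qE a).1.
Qed.

Lemma st_nf_choice : exists q : multinom n -> Kx,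
  forall a, std (q a) /\ J (mpolyX K a - q a).
Proof.
have H a : exists q, std q /\ J (mpolyX K a - q).
  by have [q sq Jq] := st_nf (mpolyX K a); exists q.
have [q qE] := boolp.choice H; by exists q.
Qed.

Lemma std_reprP f : std (std_repr J le f) /\ quot_proj J (std_repr J le f) = f.
Proof.
have [q sq Jq] := st_nf (quot_repr f).
have [] : [set p | std p /\ quot_proj J p = f] (std_repr J le f).
  apply: (xgetPex 0); exists q; split=> //.
  by rewrite -[RHS]quot_reprK; apply/esym/quot_projP.
by split.
Qed.

(** For every monomial x^a of p, the monomial x^a t^k is a multiple of
    x^a t^a by an element of the toric monoid. *)
Definition above (k : Zn) (p : Kx) : Prop :=
  forall a, a \in msupp p -> S (k - expv int a).

Lemma zvecB (k l : Zn) : zvec R (k - l) = zvec R k - zvec R l.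
Proof. by apply/rowP => i; rewrite !mxE rmorphB. Qed.

Lemma zvec_expv (a : multinom n) : zvec R (expv int a) = expv R a.
Proof. by apply/rowP => i; rewrite !mxE rmorph_nat. Qed.

(** Exponents k with x^a in the filtration step k, written with weights. *)
Lemma toric_dot k (a : multinom n) : S (k - expv int a) <->
  forall w, C w -> dot w (zvec R k) <= dot w (expv R a).
Proof.
have E w : dot w (- zvec R (k - expv int a)) = dot w (expv R a) - dot w (zvec R k).
  by rewrite zvecB zvec_expv opprB dotDr dotNr.
by split=> Sk w Cw; have := Sk w Cw; rewrite E subr_ge0.
Qed.

(** A monomial of the normal form of p comes from the normal form of a monomial
    of p, and these do not lower the weights of C. *)
Lemma above_nf k p q : std q -> J (p - q) -> above k p -> above k q.
Proof.
move=> sq Jpq pk b bq; have [h hE] := st_nf_choice.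
have bh : exists2 a, a \in msupp p & b \in msupp (h a).
  apply: contrapT => nb; move: bq; rewrite mcoeff_msupp (std_nf_linear hE sq Jpq).
  rewrite raddf_sum big_seq big1 ?eqxx // => a ap /=.
  rewrite mcoeffZ [mcoeff b _]memN_msupp_eq0 ?mulr0 //; apply/negP => bha.
  by apply: nb; exists a.
have [a ap bha] := bh; apply/toric_dot => w Cw.
have /toric_dot/(_ w Cw) ka := pk a ap; apply: le_trans ka _.
by have [sh Jh] := hE a; apply: nf_raises sh Jh w Cw b bha.
Qed.

(** By [above_nf], any representative can be used to bound the
    quasivaluation from below, not only the normal form; the filtration is then
    visibly multiplicative. *)
Lemma filtP k f : filt J le C k f <-> exists2 p, quot_proj J p = f & above k p.
Proof.
have [sr rE] := std_reprP f; split=> [kf|[p pf pk] [w Cw]].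
  exists (std_repr J le f) => // a af; apply/toric_dot.
  suff : dual_cone C (expv R a - zvec R k).
    by move=> + w Cw => /(_ w Cw); rewrite dotDr dotNr subr_ge0.
  apply: lattice_test => w Cw; rewrite dotDr dotNr subr_ge0 -zvec_expv.
  rewrite !dot_zvec ler_int.
  by have /le_min_weight := kf (exist _ w Cw); apply.
apply/le_min_weight => a af /=; rewrite -(ler_int R) -!dot_zvec zvec_expv.
apply: (toric_dot k a).1 => //.
by apply: (above_nf sr _ pk) => //; apply/quot_projP; rewrite pf.
Qed.

Lemma filt0 k : filt J le C k 0.
Proof.
apply/filtP; exists 0; first by rewrite rmorph0.
by move=> a; rewrite (@msupp0 n K).
Qed.

Lemma filtB k f g : filt J le C k f -> filt J le C k g -> filt J le C k (f - g).
Proof.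
move=> /filtP[p <- pk] /filtP[q <- qk]; apply/filtP; exists (p - q).
  exact: rmorphB.
by move=> a /msuppB_le; rewrite mem_cat => /orP[/pk|/qk].
Qed.

Lemma filtD k f g : filt J le C k f -> filt J le C k g -> filt J le C k (f + g).
Proof.
move=> kf kg; rewrite -[g]opprK; apply: filtB => //; rewrite -sub0r.
by apply: filtB => //; apply: filt0.
Qed.

Lemma filtM k l f g :
  filt J le C k f -> filt J le C l g -> filt J le C (k + l) (f * g).
Proof.
move=> /filtP[p <- pk] /filtP[q <- ql]; apply/filtP; exists (p * q).
  exact: rmorphM.
move=> c /msuppM_le /allpairsP[[a b] /= [ap bq ->]].
by rewrite expvD opprD addrACA; apply: toric_monoidD; [apply: pk|apply: ql].
Qed.

Lemma filt_monomial a : filt J le C (expv int a) (bar a).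
Proof.
apply/filtP; exists (mpolyX K a) => // b; rewrite msuppX inE => /eqP ->.
by rewrite subrr; apply: toric_monoid0.
Qed.

Lemma rees_subring : subring_closed (set_pred (rees_set J le C)).
Proof.
split=> [|g h /set_predP Fg /set_predP Fh|g h /set_predP Fg /set_predP Fh].
- apply/set_predP => k; rewrite gcoef_term; have [<-|_] := eqVneq 0 k.
    by rewrite -bar0 -(expv0 int n); apply: filt_monomial.
  exact: filt0.
- by apply/set_predP => k; rewrite raddfB /=; apply: filtB.
- apply/set_predP => k; rewrite gmulE /gmul raddf_sum.
  elim/big_rec: _ => [|i x _ Fx]; first exact: filt0.
  apply: filtD => //; rewrite raddf_sum /=.
  elim/big_rec: _ => [|j y _ Fy]; first exact: filt0.
  apply: filtD => //; rewrite gcoef_term; case: eqP => [<-|_]; last exact: filt0.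
  exact: filtM.
Qed.

Section Independence.
Variables (M : zmodType) (phi : multinom n -> M).
Local Open Scope fset_scope.
Local Open Scope ring_scope.

(** A[M] is free over K[M] on the standard monomials, shifted in an arbitrary
    way by phi: a coefficient of a relation is a relation of A between
    standard monomials.  Both families embed in such a ring. *)
Lemma group_ring_indep (s : {fset multinom n}) (a : multinom n -> group_ring K M) :
    (forall i, i \in s -> st i) ->
    \sum_(i <- s) gcoef_map M cst (a i) * gterm (bar i) (phi i) = 0 ->
  forall i, i \in s -> a i = 0.
Proof.
move=> ss sum0 i si; apply/gcoefP => k; rewrite raddf0 /=.
(* The coefficient of t^(k + phi i) in the relation, lifted to K[x]. *)
pose f := \sum_(j <- s) gcoef (k + phi i - phi j) (a j) *: mpolyX K j.
have fE j : j \in s -> mcoeff j f = gcoef (k + phi i - phi j) (a j).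
  move=> sj; rewrite raddf_sum (bigD1_seq j) //= mcoeffZ mcoeffX eqxx mulr1.
  rewrite big1 ?addr0 // => l lj; rewrite mcoeffZ mcoeffX (negbTE lj) mulr0 //.
suff f0 : f = 0 by have := fE i si; rewrite addrK f0 mcoeff0.
apply: st_indep.
  rewrite -[f]subr0; apply/quot_projP; rewrite rmorph0.
  have := congr1 (gcoef (k + phi i)) sum0; rewrite raddf0 => <-.
  rewrite !raddf_sum; apply: eq_bigr => j _ /=.
  by rewrite gcoef_mul_term gcoef_gcoef_map -mul_mpolyC rmorphM.
move=> j; rewrite mcoeff_msupp; have [sj _|sj] := boolP (j \in s); first exact: ss.
rewrite raddf_sum big_seq big1 ?eqxx // => l sl /=.
by rewrite mcoeffZ mcoeffX; case: eqP sl sj => [-> ->//|]; rewrite mulr0.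
Qed.
End Independence.

(** * The Rees algebra *)
Section Rees.
Variable hS : subring_closed (set_pred (rees_set J le C)).
Local Notation Rees := (subring_of hS).

Lemma structure_morphism_ex : exists psi : {rmorphism toric_algebra K C -> Rees},
  forall g k, gcoef k (val (psi g)) = cst (gcoef k (toric_val g)).
Proof.
pose F : {rmorphism toric_algebra K C -> group_ring A Zn} :=
  gcoef_map Zn cst \o @toric_val K R n C.
have [|psi psiE] := @lift_injective _ _ _
    (val : {rmorphism Rees -> group_ring A Zn}) F val_inj.
  move=> g.
  have Fg : F g \in set_pred (rees_set J le C).
    apply/set_predP => k; rewrite gcoef_gcoef_map.
    have [->|gk] := eqVneq (gcoef k (toric_val g)) 0.
      by rewrite rmorph0; apply: filt0.
    apply/filtP; exists (mpolyC n (gcoef k (toric_val g))) => // a.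
    rewrite msuppC; case: ifP => // _; rewrite inE => /eqP ->.
    rewrite expv0 subr0; have /set_predP := valP g; exact.
  by exists (Sub (F g) Fg : Rees).
by exists psi => g k; rewrite psiE gcoef_gcoef_map.
Qed.

Lemma rees_monomial_ex a : exists x : Rees, val x = gterm (bar a) (expv int a).
Proof.
have xR : gterm (bar a) (expv int a) \in set_pred (rees_set J le C).
  apply/set_predP => k; rewrite gcoef_term; case: eqP => [<-|_].
    exact: filt_monomial.
  exact: filt0.
by exists (Sub (gterm (bar a) (expv int a)) xR : Rees).
Qed.

(** The element x^a t^a. *)
Definition rees_monomial a : Rees := sval (cid (rees_monomial_ex a)).

Lemma val_rees_monomial a : val (rees_monomial a) = gterm (bar a) (expv int a).
Proof. by rewrite /rees_monomial; case: cid. Qed.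

Variable psi : {rmorphism toric_algebra K C -> Rees}.
Hypothesis psiE : forall g k, gcoef k (val (psi g)) = cst (gcoef k (toric_val g)).

Lemma val_psi g : val (psi g) = gcoef_map Zn cst (toric_val g).
Proof. by apply/gcoefP => k; rewrite psiE gcoef_gcoef_map. Qed.

(** The values in A[Z^n] of elements of the Rees algebra seen as a module; the
    name keeps the two structures on the carrier apart. *)
Definition rees_val (x : push_module psi) : group_ring A Zn := val (x : Rees).

Lemma rees_val_inj : injective rees_val.
Proof. exact: val_inj. Qed.

Lemma rees_val0 : rees_val 0 = 0.
Proof. by []. Qed.

Lemma rees_val_sum (T : Type) (s : seq T) (F : T -> push_module psi) :
  rees_val (\sum_(i <- s) F i) = \sum_(i <- s) rees_val (F i).
Proof.
elim: s => [|i s IH]; first by rewrite !big_nil.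
by rewrite !big_cons -IH.
Qed.

Lemma rees_val_term a b :
  rees_val (a *: (rees_monomial b : push_module psi)) =
  gcoef_map Zn cst (toric_val a) * gterm (bar b) (expv int b).
Proof.
transitivity (val (psi a * rees_monomial b)); first by [].
by rewrite rmorphM -val_psi -val_rees_monomial.
Qed.

Lemma toric_term c l : S l -> exists g : toric_algebra K C, toric_val g = gterm c l.
Proof.
move=> Sl; have gT : gterm c l \in set_pred (@toric_set K R n C).
  apply/set_predP => k; rewrite gcoef_term; have [<- //|_] := eqVneq l k.
  by rewrite eqxx.
by exists (Sub (gterm c l) gT : toric_algebra K C).
Qed.

(** A standard term c x^b t^k of an element of the Rees algebra has k - b in
    the toric monoid, and equals c t^(k - b) times x^b t^b. *)
Lemma rees_generating : generating (M := push_module psi) st rees_monomial.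
Proof.
move=> x; pose q k := std_repr J le (gcoef k (val x)).
have sq k : std (q k) by have [] := std_reprP (gcoef k (val x)).
have qE k : quot_proj J (q k) = gcoef k (val x).
  by have [] := std_reprP (gcoef k (val x)).
have qk k : above k (q k).
  have /set_predP/(_ k)/filtP[p pE pk] := valP x.
  by apply: (above_nf (sq k) _ pk); apply/quot_projP; rewrite pE qE.
have /boolp.choice[t tE] (kb : Zn * multinom n) : exists g : toric_algebra K C,
    kb.2 \in msupp (q kb.1) ->
    toric_val g = gterm (mcoeff kb.2 (q kb.1)) (kb.1 - expv int kb.2).
  have [/qk Sb|_] := boolP (kb.2 \in msupp (q kb.1)); last by exists 0.
  by have [g gE] := toric_term (mcoeff kb.2 (q kb.1)) Sb; exists g.
exists [seq (t (k, b), b) | k <- gsupp (val x), b <- msupp (q k)].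
  by move=> _ /allpairsPdep[k [b [_ /sq sb ->]]].
apply: rees_val_inj; rewrite rees_val_sum big_allpairs_dep.
rewrite /rees_val [LHS]group_ringE; apply: eq_bigr => k _.
rewrite -qE quot_proj_cst gterm_sum big_seq [RHS]big_seq.
apply: eq_bigr => b bq; rewrite -/(rees_val _) rees_val_term (tE (k, b)) //=.
by rewrite gcoef_map_term gtermM subrK.
Qed.

Lemma rees_independent : independent (M := push_module psi) st rees_monomial.
Proof.
move=> s a ss sum0 i si.
have a0 : \sum_(j <- s) gcoef_map Zn cst (toric_val (a j)) *
    gterm (bar j) (expv int j) = 0.
  transitivity (rees_val (\sum_(j <- s) a j *: (rees_monomial j : push_module psi))).
    rewrite rees_val_sum; by apply: eq_bigr => j _; rewrite rees_val_term.
  by rewrite sum0; apply: rees_val0.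
have ai0 := group_ring_indep (a := fun i => toric_val (a i)) ss a0 si.
by apply: val_inj; exact: ai0.
Qed.
End Rees.

(** * The lifted algebra *)
Section Lift.
Variables (m : nat) (r : 'I_m -> Zn).
Hypothesis rC : forall i, C (zvec R (r i)).
Local Notation Zm := 'rV[int]_m.
Local Notation Kt := (mpoly m K).
Local Notation Ktx := (mpoly n Kt).
Local Notation LA := (lift_algebra r J).
Local Notation lproj := (quot_proj (lift_ideal r J)).

(** The exponents in Z^m of the image of t^k: the Cox morphism is
    t^k -> t^(- r.k) on the toric monoid. *)
Definition neg_dot (k : Zn) : Zm := \row_i - dot (r i) k.

Lemma neg_dotD k l : neg_dot (k + l) = neg_dot k + neg_dot l.
Proof. by apply/rowP => i; rewrite !mxE dotDr opprD. Qed.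

Lemma lift_mu_le (f : Kx) i a : a \in msupp f -> lift_mu r f i <= dot (r i) (expv int a).
Proof.
move=> af; have f0 : f <> 0 by move=> f0; rewrite f0 (@msupp0 n K) in af.
have [c [_ cE cmin]] := min_weight_attained (r i) f0.
by rewrite /lift_mu cE; apply: cmin.
Qed.

Lemma expv_lift_exp (f : Kx) a : a \in msupp f ->
  expv int (lift_exp r f a) + neg_dot (expv int a) = \row_i - lift_mu r f i.
Proof.
move=> af; apply/rowP => i; rewrite !mxE mnm_tnth tnth_mktuple natz gez0_abs.
  by rewrite addrAC subrr add0r.
by rewrite subr_ge0 lift_mu_le.
Qed.

Lemma expv_cox_exp k : S k -> expv int (cox_exp r k) = neg_dot k.
Proof.
move=> Sk; apply/rowP => i; rewrite !mxE mnm_tnth tnth_mktuple natz.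
by rewrite abszE ler0_norm // (cox_le0 rC).
Qed.

(** The lift of f goes to t^(- mu(f)) times the class of f, that is to 0. *)
Lemma lift_embedding : exists E : {rmorphism LA -> group_ring A Zm},
  forall c a, E (lproj (c *: mpolyX Kt a)) =
    gcoef_map Zm cst (laurent K m c) * gterm (bar a) (neg_dot (expv int a)).
Proof.
pose t : {rmorphism Kt -> group_ring A Zm} := gcoef_map Zm cst \o laurent K m.
have [||E0 E0E] := @poly_extension n Kt (group_ring A Zm) t
    (fun a => gterm (bar a) (neg_dot (expv int a))).
- rewrite bar0 expv0; congr (gterm 1 _); apply/rowP => i.
  by rewrite !mxE /dot big1 ?oppr0 // => j _; rewrite mxE mulr0.
- by move=> a b; rewrite gtermM barD expvD neg_dotD.
have [|E EE] := @quot_factor _ _ [set lift_poly r f | f in [set f | J f /\ f <> 0]] E0.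
  move=> _ [f [Jf _] <-]; rewrite raddf_sum big_seq.
  transitivity (\sum_(a <- msupp f)
      gterm (cst (mcoeff a f) * bar a) (\row_i - lift_mu r f i)).
    rewrite [RHS]big_seq; apply: eq_bigr => a af /=.
    rewrite E0E /t /= laurentX gcoef_map_term gtermM.
    by rewrite (expv_lift_exp af).
  rewrite -gterm_sum -quot_proj_cst.
  have -> : quot_proj J f = quot_proj J 0 by apply/quot_projP; rewrite subr0.
  by rewrite rmorph0 gterm0.
by exists E => c a; rewrite EE E0E.
Qed.

(** The lift of x^a - q: as r_i lies in C, the weight of x^a is minimal, so
    x^a carries no power of t. *)
Lemma lift_relation a q : std q -> J (mpolyX K a - q) ->
  lproj (mpolyX Kt a) = \sum_(b <- msupp q)
    lproj ((mcoeff b q *: mpolyX K (cox_exp r (expv int b - expv int a)))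
           *: mpolyX Kt b).
Proof.
move=> sq Jf; set f := mpolyX K a - q in Jf.
(* mext t e is the lift, additive in its argument, for the fixed mu = r.a *)
pose t : {rmorphism K -> Ktx} := @mpolyC n Kt \o @mpolyC m K.
pose e b : Ktx := mpolyX K (cox_exp r (expv int b - expv int a)) *: mpolyX Kt b.
have tE c b : t c * e b =
    (c *: mpolyX K (cox_exp r (expv int b - expv int a))) *: mpolyX Kt b.
  by rewrite /t /= mul_mpolyC /e scalerA mul_mpolyC.
have LJ : lift_ideal r J (mext t e f).
  have [->|f0] := pselect (f = 0); first by rewrite raddf0; apply: ideal0.
  have aq : a \notin msupp q.
    apply/negP => aq; apply/f0/st_indep => // b /msuppB_le.
    by rewrite mem_cat msuppX inE => /orP[/eqP ->|]; apply: sq.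
  have af : a \in msupp f.
    by rewrite mcoeff_msupp mcoeffB mcoeffX eqxx [mcoeff a q]memN_msupp_eq0 // subr0 oner_neq0.
  suff -> : mext t e f = lift_poly r f by apply: mem_gen; exists f.
  apply: eq_bigr => b _; rewrite tE; congr ((_ *: mpolyX K _) *: _).
  apply/mnmP => i; rewrite !mnm_tnth !tnth_mktuple dotDr dotNr.
  congr `|_ - _|%N; have [c [cf cE cmin]] := min_weight_attained (r i) f0.
  rewrite /lift_mu cE /=; apply/eqP; rewrite eq_le cmin // andbT.
  move: cf => /msuppB_le; rewrite mem_cat msuppX inE => /orP[/eqP -> //|cq].
  rewrite -(ler_int R) -!dot_zvec !zvec_expv.
  exact: nf_raises sq Jf _ (rC i) _ cq.
have -> : lproj (mpolyX Kt a) = lproj (mext t e q).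
  apply/quot_projP; suff <- : mext t e f = mpolyX Kt a - mext t e q by [].
  rewrite /f raddfB /= -[mpolyX K a]scale1r mextX rmorph1 mul1r /e subrr.
  suff -> : cox_exp r 0 = mnm0 by rewrite mpolyX0 scale1r.
  apply/mnmP => i; rewrite mnm0E mnm_tnth tnth_mktuple.
  by rewrite /dot big1 // => j _; rewrite mxE mulr0.
by rewrite raddf_sum; apply: eq_bigr => b _; rewrite /= tE.
Qed.

Definition lift_monomial (a : multinom n) : push_module (pi_sharp r J) :=
  lproj (mpolyX Kt a).

Lemma lift_scale c a : c *: lift_monomial a = lproj (c *: mpolyX Kt a).
Proof. by rewrite -mul_mpolyC rmorphM. Qed.

Lemma lift_generating : generating st lift_monomial.
Proof.
move=> x; have [q qE] := st_nf_choice.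
rewrite -[x](@quot_reprK _ (lift_ideal r J)); set F := quot_repr _.
pose k a b := mcoeff a F *
  (mcoeff b (q a) *: mpolyX K (cox_exp r (expv int b - expv int a))).
exists [seq (k a b, b) | a <- msupp F, b <- msupp (q a)].
  by move=> _ /allpairsPdep[a [b [_ bq ->]]]; apply: (qE a).1.
rewrite big_allpairs_dep.
transitivity (\sum_(a <- msupp F) lproj (mcoeff a F *: mpolyX Kt a)).
  by rewrite {1}(mpolyE F) (rmorph_sum lproj).
apply: eq_bigr => a _; rewrite -mul_mpolyC (rmorphM lproj) /=.
rewrite (lift_relation (qE a).1 (qE a).2) mulr_sumr; apply: eq_bigr => b _.
by rewrite lift_scale -(rmorphM lproj) mul_mpolyC scalerA.
Qed.

Section Embedding.
Variable E : {rmorphism LA -> group_ring A Zm}.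
Hypothesis EE : forall c a, E (lproj (c *: mpolyX Kt a)) =
  gcoef_map Zm cst (laurent K m c) * gterm (bar a) (neg_dot (expv int a)).

Lemma embedding_sum (s : {fset multinom n}) (a : multinom n -> Kt) :
  E (\sum_(i <- s) a i *: lift_monomial i) =
  \sum_(i <- s) gcoef_map Zm cst (laurent K m (a i)) *
    gterm (bar i) (neg_dot (expv int i)).
Proof.
have -> : E (\sum_(i <- s) a i *: lift_monomial i) =
    \sum_(i <- s) E (a i *: lift_monomial i) by exact: (rmorph_sum E).
by apply: eq_bigr => i _; rewrite lift_scale EE.
Qed.

Lemma embedding_indep (s : {fset multinom n}) (a : multinom n -> Kt) :
    (forall i, i \in s -> st i) ->
    E (\sum_(i <- s) a i *: lift_monomial i) = 0 ->
  forall i, i \in s -> a i = 0.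
Proof.
move=> ss; rewrite embedding_sum => sum0 i si; apply: laurent_inj; rewrite rmorph0.
exact: (group_ring_indep (phi := fun i => neg_dot (expv int i))
  (a := fun i => laurent K m (a i)) ss sum0 si).
Qed.

Lemma lift_independent : independent st lift_monomial.
Proof. by move=> s a ss sum0; apply: embedding_indep ss _; rewrite sum0 rmorph0. Qed.

(** The generators of the lifted algebra have independent images. *)
Lemma embedding_inj : injective E.
Proof.
move=> x y /eqP; rewrite -subr_eq0 -rmorphB => /eqP Exy.
apply/eqP; rewrite -subr_eq0; apply/eqP; move: (x - y) Exy => {x y} x.
have [[s a] [/= ss _ ->]] := expands_ex lift_generating x.
move=> /(embedding_indep ss) a0; rewrite big_seq big1 // => i /a0 ->.
exact: (@scale0r _ (push_module (pi_sharp r J))).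
Qed.
End Embedding.

(** * The Cartesian square *)
Section Square.
Variable hS : subring_closed (set_pred (rees_set J le C)).
Local Notation Rees := (subring_of hS).
Variable psi : {rmorphism toric_algebra K C -> Rees}.
Hypothesis psiE : forall g k, gcoef k (val (psi g)) = cst (gcoef k (toric_val g)).
Local Notation mono := (rees_monomial hS).

(** The morphism t^k -> t^(- r.k) of group rings extends the Cox morphism. *)
Lemma cox_laurent (T : {rmorphism group_ring A Zn -> group_ring A Zm})
    (TE : forall a k, T (gterm a k) = gterm a (neg_dot k)) g :
  T (gcoef_map Zn cst (toric_val g)) = gcoef_map Zm cst (laurent K m (cox_sharp K rC g)).
Proof.
have Sg k : k \in gsupp (toric_val g) -> S k.
  by rewrite mem_gsupp; have /set_predP := valP g; apply.
rewrite {1}(group_ringE (toric_val g)) /= /cox_fun /cox_ext !rmorph_sum.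
rewrite big_seq [RHS]big_seq; apply: eq_bigr => k /Sg Sk /=.
by rewrite laurentX !gcoef_map_term TE expv_cox_exp.
Qed.

(** The ambient morphism A[Z^n] -> A[Z^m] maps the basis c x^a t^a of the Rees
    algebra to the image of cox(c) x^a, which lies in the embedded lifted
    algebra. *)
Lemma rees_to_lift_ex : exists phi : {rmorphism Rees -> LA},
  (forall g, phi (psi g) = pi_sharp r J (cox_sharp K rC g)) /\
  (forall a, phi (mono a) = lproj (mpolyX Kt a)).
Proof.
have [T TE] := @group_ring_map A A Zn Zm idfun neg_dot neg_dotD.
have {}TE a k : T (gterm a k) = gterm a (neg_dot k) by rewrite TE.
have [E EE] := lift_embedding; have Einj := embedding_inj EE.
have Tterm g a : T (gcoef_map Zn cst (toric_val g) * gterm (bar a) (expv int a)) =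
    E (lproj (cox_sharp K rC g *: mpolyX Kt a)).
  by rewrite EE rmorphM TE (cox_laurent TE).
pose V : {rmorphism Rees -> group_ring A Zn} := (val : Rees -> group_ring A Zn).
have [x|phi phiE] := @lift_injective Rees LA _ E (T \o V) Einj.
  have [s sB xE] := rees_generating psiE x.
  exists (\sum_(c <- s) lproj (cox_sharp K rC c.1 *: mpolyX Kt c.2)).
  transitivity (T (rees_val (psi := psi) x)); last by [].
  rewrite xE rees_val_sum (rmorph_sum E) (rmorph_sum T).
  by apply: eq_bigr => c _; rewrite (rees_val_term psiE) Tterm.
exists phi; split=> [g|a]; apply: Einj; rewrite phiE.
  transitivity (T (val (psi g))); first by [].
  rewrite (val_psi psiE) (cox_laurent TE).
  have -> : pi_sharp r J (cox_sharp K rC g) =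
      lproj (cox_sharp K rC g *: mpolyX Kt mnm0).
    by rewrite mpolyX0 -mul_mpolyC mulr1.
  rewrite EE bar0 expv0.
  have -> : neg_dot 0 = 0 by apply: (addrI (neg_dot 0)); rewrite -neg_dotD !addr0.
  by rewrite -/(gone A Zm) (mulr1 (gcoef_map _ _ _)).
transitivity (T (val (mono a))); first by [].
rewrite val_rees_monomial TE -[mpolyX Kt a]scale1r EE rmorph1.
by rewrite rmorph1 mul1r.
Qed.

Lemma rees_monomialD a b : mono (mnm_add a b) = mono a * mono b.
Proof.
apply: val_inj; rewrite val_rees_monomial rmorphM.
transitivity (gterm (bar a) (expv int a) * gterm (bar b) (expv int b)).
  by rewrite gtermM barD expvD.
by rewrite -!(val_rees_monomial hS).
Qed.

Lemma rees_monomial0 : mono (mnm0 (n := n)) = 1.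
Proof. by apply: val_inj; rewrite val_rees_monomial bar0 expv0. Qed.

(** The relation x^a = q of A, homogenized with coefficients in the toric
    algebra: x^a t^a is the sum of the q_b t^(a - b) x^b t^b. *)
Lemma rees_relation a q : std q -> J (mpolyX K a - q) ->
  exists g : multinom n -> toric_algebra K C,
    (forall b, b \in msupp q -> cox_sharp K rC (g b) =
      mcoeff b q *: mpolyX K (cox_exp r (expv int a - expv int b))) /\
    mono a = \sum_(b <- msupp q) psi (g b) * mono b.
Proof.
move=> sq Jq.
have qa : above (expv int a) q.
  apply: (above_nf sq Jq) => b; rewrite msuppX inE => /eqP ->.
  by rewrite subrr; apply: toric_monoid0.
have /boolp.choice[g gE] b : exists g : toric_algebra K C, b \in msupp q ->
    toric_val g = gterm (mcoeff b q) (expv int a - expv int b).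
  have [/qa Sb|_] := boolP (b \in msupp q); last by exists 0.
  by have [g gE] := toric_term (mcoeff b q) Sb; exists g.
exists g; split=> [b /gE gb|]; first by rewrite /= /cox_fun gb cox_ext_term.
apply: val_inj; rewrite val_rees_monomial rmorph_sum.
transitivity (gterm (quot_proj J q) (expv int a)).
  by have -> : bar a = quot_proj J q by apply/quot_projP.
rewrite quot_proj_cst gterm_sum big_seq [RHS]big_seq; apply: eq_bigr => b bq.
rewrite rmorphM.
transitivity (gcoef_map Zn cst (toric_val (g b)) * gterm (bar b) (expv int b)).
  by rewrite gE // gcoef_map_term gtermM subrK.
by rewrite -(val_psi psiE) -(val_rees_monomial hS).
Qed.

Lemma lift_exp_shift (f : Kx) a b : a \in msupp f ->
    (forall w, C w -> dot w (expv R a) <= dot w (expv R b)) ->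
  mnm_add (lift_exp r f a) (cox_exp r (expv int a - expv int b)) = lift_exp r f b.
Proof.
move=> af ab; apply/mnmP => i; rewrite mnmDE !mnm_tnth !tnth_mktuple.
have mu_a := lift_mu_le i af.
have {}ab : dot (r i) (expv int a) <= dot (r i) (expv int b).
  by rewrite -(ler_int R) -!dot_zvec !zvec_expv; apply: ab.
apply/eqP; rewrite -eqz_nat PoszD dotDr dotNr !abszE.
rewrite ger0_norm ?subr_ge0 // ler0_norm ?subr_le0 // ger0_norm; last first.
  by rewrite subr_ge0 (le_trans mu_a).
by rewrite opprB; apply/eqP; rewrite [LHS]addrC [LHS]addrA subrK.
Qed.

(** The morphism x^a -> b(x^a t^a) over t must kill the lift of f.  By
    [rees_relation], b(x^a t^a) can be expanded on standard monomials; the value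
    at the lift of f becomes a homogenization, linear in its argument, of the
    normal form of f, and this normal form is 0. *)
Lemma square_cartesian (phi : {rmorphism Rees -> LA}) :
    (forall g, phi (psi g) = pi_sharp r J (cox_sharp K rC g)) ->
    (forall a, phi (mono a) = lproj (mpolyX Kt a)) ->
  cartesian_square psi (cox_sharp K rC) phi (pi_sharp r J).
Proof.
move=> phi_psi phi_mono; split=> // Q b t bt.
have [||q qE] := @poly_extension n Kt Q t (fun a => b (mono a)).
- by rewrite rees_monomial0 rmorph1.
- by move=> a a'; rewrite rees_monomialD rmorphM.
have [h hE] := st_nf_choice.
have [|p pE] := @quot_factor _ _ [set lift_poly r f | f in [set f | J f /\ f <> 0]] q.
  move=> _ [f [Jf _] <-].
  pose t0 : {rmorphism K -> Q} := t \o @mpolyC m K.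
  (* the value at the homogenization of a polynomial, for the fixed mu(f) *)
  pose L := mext t0 (fun c => t (mpolyX K (lift_exp r f c)) * b (mono c)).
  have Lf : \sum_(a <- msupp f) L (mcoeff a f *: h a) = 0.
    rewrite -(raddf_sum (mext t0 _)) -(@std_nf_linear h f 0) ?raddf0 ?addr0 //.
    by move=> a; rewrite (@msupp0 n K).
  rewrite -[RHS]Lf rmorph_sum big_seq [RHS]big_seq; apply: eq_bigr => a af.
  rewrite qE; have [g [gE ->]] := rees_relation (hE a).1 (hE a).2.
  rewrite rmorph_sum mulr_sumr /L (mextEw _ _ (msupp_uniq (h a)) (@msuppZ_le _ _ _ _)).
  rewrite big_seq [RHS]big_seq; apply: eq_bigr => c ch.
  rewrite rmorphM bt gE // mulrA -rmorphM mulrA; congr (_ * _).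
  rewrite mcoeffZ /t0 /= -rmorphM; congr (t _).
  rewrite mul_mpolyC -scalerAl -scalerAr scalerA -mpolyXD lift_exp_shift //.
  by move=> w Cw; apply: nf_raises (hE a).1 (hE a).2 w Cw _ ch.
exists p; split=> [x|x|p' pb pt y].
- have [s _ ->] := rees_generating psiE x.
  rewrite (rmorph_sum b) (rmorph_sum phi) (rmorph_sum p).
  apply: eq_bigr => c _.
  have -> : phi (c.1 *: (mono c.2 : push_module psi)) = phi (psi c.1) * phi (mono c.2).
    exact: (rmorphM phi).
  have -> : b (c.1 *: (mono c.2 : push_module psi)) = b (psi c.1) * b (mono c.2).
    exact: (rmorphM b).
  rewrite phi_psi phi_mono bt (rmorphM p) pE -[mpolyX Kt c.2]scale1r pE !qE.
  rewrite rmorph1 mul1r; congr (_ * _).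
  by rewrite -[RHS]mulr1 -(rmorph1 b) -rees_monomial0 -qE mpolyX0 -mul_mpolyC mulr1.
- rewrite /= pE -[RHS]mulr1 -(rmorph1 b) -rees_monomial0 -qE mpolyX0.
  by rewrite -mul_mpolyC mulr1.
rewrite -[y](@quot_reprK _ (lift_ideal r J)) pE; set F := quot_repr _.
rewrite (mpolyE F) (rmorph_sum lproj) (rmorph_sum p') (rmorph_sum q).
apply: eq_bigr => a _; rewrite qE -mul_mpolyC (rmorphM lproj) (rmorphM p').
by congr (_ * _); [exact: pt | rewrite -pb phi_mono].
Qed.
End Square.
End Lift.
End Families.

Theorem theorem1p2 (K : closedFieldType) (R : realType) (n m : nat)
  (J : ideal (mpoly n K)) (C : set 'rV[R]_n) (le : rel (multinom n))
  (r : 'I_m -> 'rV[int]_n)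
  (hJ : weighted_homogeneous J)
  (hC : maximal_cone J C)
  (hle : term_order le)
  (hcomp : compatible J C le)
  (hr : ray_generators J C r) :
  exists (hS : subring_closed (set_pred (rees_set J le C)))
         (psi_sharp : {rmorphism toric_algebra K C -> subring_of hS})
         (phi : {rmorphism subring_of hS -> lift_algebra r J}),
    [/\ forall g k, gcoef k (val (psi_sharp g)) =
          quot_proj J (mpolyC n (gcoef k (toric_val g))),
        cartesian_square psi_sharp (cox_sharp K (ray_in_cone hr))
          phi (pi_sharp r J),
        flat (push_module psi_sharp) /\ flat (push_module (pi_sharp r J)),
        direct_sum_of_line_bundles (push_module psi_sharp) (standard_basis J le) &
        direct_sum_of_line_bundles (push_module (pi_sharp r J))
          (standard_basis J le)].
Proof.
have [indep nf raises lattice] := standard_monomials hJ hC hcomp.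
have hS := rees_subring indep nf raises lattice.
have [psi psiE] := structure_morphism_ex indep nf raises lattice hS.
pose rC := ray_in_cone hr.
have [phi [phi_psi phi_mono]] := rees_to_lift_ex indep nf raises lattice rC psiE.
have [E EE] := lift_embedding J r.
have barI := bar_inj indep.
have gR := rees_generating indep nf raises lattice psiE.
have iR : independent (M := push_module psi) (standard J le)
    (rees_monomial indep nf raises lattice hS).
  exact: rees_independent psiE.
have gL := lift_generating indep nf raises rC.
have iL := lift_independent indep EE.
exists hS, psi, phi; split.
- exact: psiE.
- exact: square_cartesian.
- by split; [exact (free_flat gR iR)|exact (free_flat gL iL)].
- exact: (free_direct_sum gR iR barI).
- exact: (free_direct_sum gL iL barI).
Qed.
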